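(* For every integer $n\ge 1$ there exists an integer $p'$, depending only on $n$, such that the following holds. Let $B^+\subset\mathbb{C}^n$ be the ball of radius $\frac{11}{10}$ centered at the origin, and let $B\subset B^+$ be the ball of radius $1$ centered at the origin. Let $\delta$ be a constant with $0<\delta<\frac14$, and let $\eta=\delta\,(\log(\delta^{-1}))^{-p'}$. Let $f:B^+\to\mathbb{C}$ be a smooth function satisfying the bounds $|f|_{C^1(B^+)}\le 1$ and $|\bar\partial f|_{C^2(B^+)}\le\eta$. Then there exists $w=(w_0,w_1,\dots,w_n)\in\mathbb{C}^{n+1}$ with $|w|\le\delta$ such that the function $f-w_0-\sum_{i=1}^n w_i z_i$ is $\eta$-transverse to $0$ over $B$.
   Context: Here $z_1,\dots,z_n$ are the standard complex coordinates on $\mathbb{C}^n$, $|\cdot|$ is the standard Hermitian norm, and $\bar\partial f$ is the $(0,1)$-part of the differential of $f$ with respect to the standard complex structure. $|\cdot|_{C^r(B^+)}$ denotes the usual $C^r$ norm over $B^+$ (sup norms of derivatives up to order $r$). The function $f$ is complex-valued and not assumed holomorphic. Definition. For $\eta>0$, a smooth function $F$ with values in $\mathbb{C}^m$ (here $m=1$) is $\eta$-transverse to $0$ over $B$ if at every point $z\in B$ where $|F(z)|<\eta$, the (real-linear) differential $\nabla F(z):\mathbb{C}^n\to\mathbb{C}^m$ is surjective and has a right inverse of norm less than $\eta^{-1}$ with respect to the standard Euclidean metrics. *)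

(* Defs.v *)
From HB Require Import structures.
From mathcomp Require Import all_boot all_order all_algebra.
From mathcomp Require Import complex ring lra.
From mathcomp Require Import all_classical all_reals all_analysis.

Set Implicit Arguments.
Unset Strict Implicit.
Unset Printing Implicit Defensive.

Import Order.TTheory GRing.Theory Num.Theory.
Import numFieldNormedType.Exports.

Local Open Scope classical_set_scope.
Local Open Scope ring_scope.
Local Open Scope complex_scope.

(* [Rcomplex R] is the library's copy of [R[i]] carrying the structure of a
   real vector space with the modulus as an [R]-valued norm; its topology is
   the one defined by that norm. *)
Section RcomplexNormedModule.
Variable R : realType.

Lemma Rcomplex_normZ (a : R) (x : Rcomplex R) : `|a *: x| = `|a| * `|x|.
Proof.
case: x => u v; rewrite [LHS]/Num.norm /= !exprMn -mulrDr.
by rewrite sqrtrM ?sqr_ge0 // sqrtr_sqr.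
Qed.

HB.instance Definition _ :=
  PseudoMetric.copy (Rcomplex R) (pseudoMetric_normed (Rcomplex R)).
HB.instance Definition _ := isPointed.Build (Rcomplex R) 0.
HB.instance Definition _ :=
  NormedZmod_PseudoMetric_eq.Build R (Rcomplex R) erefl.
HB.instance Definition _ :=
  PseudoMetricNormedZmod_Lmodule_isNormedModule.Build R (Rcomplex R)
    Rcomplex_normZ.

End RcomplexNormedModule.

(* C^n as a real normed vector space for the standard Hermitian norm. The alias
   is needed because the norm that MathComp-Analysis puts on matrices is the
   sup norm. *)
Definition Cvec (R : realType) (n : nat) : Type := 'rV[Rcomplex R]_n.

Section CvecNormedModule.
Variables (R : realType) (n : nat).
Local Notation V := (Cvec R n).
Implicit Types x y z : V.

HB.instance Definition _ := GRing.Zmodule.copy V 'rV[Rcomplex R]_n.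

Definition Cvec_scale (a : R) (z : V) : V := \row_j (a *: z 0 j).

Definition hermitian_norm (z : V) : R := Num.sqrt (\sum_j `|z 0 j| ^+ 2).

Lemma Cvec_scaleA a b z :
  Cvec_scale a (Cvec_scale b z) = Cvec_scale (a * b) z.
Proof. by apply/rowP => j; rewrite !mxE scalerA. Qed.

Lemma Cvec_scale1 : left_id 1 Cvec_scale.
Proof. by move=> z; apply/rowP => j; rewrite !mxE scale1r. Qed.

Lemma Cvec_scaleDr : right_distributive Cvec_scale +%R.
Proof. by move=> a y z; apply/rowP => j; rewrite !mxE scalerDr. Qed.

Lemma Cvec_scaleDl z : {morph Cvec_scale^~ z : a b / a + b}.
Proof. by move=> a b; apply/rowP => j; rewrite !mxE scalerDl. Qed.

HB.instance Definition _ := GRing.Zmodule_isLmodule.Build R V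
  Cvec_scaleA Cvec_scale1 Cvec_scaleDr Cvec_scaleDl.

Let cauchy_schwarz (a b : 'I_n -> R) :
  (\sum_j a j * b j) ^+ 2 <= (\sum_j a j ^+ 2) * (\sum_j b j ^+ 2).
Proof.
suff : 0 <= \sum_i \sum_j (a i * b j - a j * b i) ^+ 2.
  under eq_bigr => i _.
    under eq_bigr => j _.
      rewrite (_ : _ ^+ 2 = a i ^+ 2 * b j ^+ 2 + b i ^+ 2 * a j ^+ 2
        - 2 * ((a i * b i) * (a j * b j))); last by ring.
    over.
    rewrite big_split big_split /= sumrN -!mulr_sumr.
  over.
  rewrite big_split big_split /= sumrN -!mulr_sumr -!mulr_suml.
  rewrite expr2; lra.
by apply: sumr_ge0 => i _; apply: sumr_ge0 => j _; exact: sqr_ge0.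
Qed.

Let sumsq_ge0 (z : V) : 0 <= \sum_j `|z 0 j| ^+ 2.
Proof. by apply: sumr_ge0 => j _; exact: sqr_ge0. Qed.

Lemma hermitian_normD x y :
  hermitian_norm (x + y) <= hermitian_norm x + hermitian_norm y.
Proof.
rewrite -(@ler_pXn2r _ 2) ?nnegrE ?addr_ge0 ?sqrtr_ge0 //.
rewrite sqrrD !sqr_sqrtr ?sumsq_ge0 //.
have cs : \sum_j `|x 0 j| * `|y 0 j| <= hermitian_norm x * hermitian_norm y.
  rewrite -sqrtrM ?sumsq_ge0 // -[leLHS]ger0_norm; last first.
    by apply: sumr_ge0 => j _; exact: mulr_ge0.
  by rewrite -sqrtr_sqr ler_wsqrtr // cauchy_schwarz.
apply: (@le_trans _ _ (\sum_j (`|x 0 j| + `|y 0 j|) ^+ 2)).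
  apply: ler_sum => j _; rewrite mxE ler_pXn2r ?nnegrE ?addr_ge0 //.
  exact: ler_normD.
under eq_bigr do rewrite sqrrD.
by rewrite !big_split /= lerD2r lerD2l mulr2n lerD.
Qed.

Lemma hermitian_normZ (a : R) x :
  hermitian_norm (a *: x) = `|a| * hermitian_norm x.
Proof.
rewrite /hermitian_norm; under eq_bigr do rewrite mxE Rcomplex_normZ exprMn.
by rewrite -mulr_sumr sqrtrM ?sqr_ge0 // sqrtr_sqr normr_id.
Qed.

Lemma hermitian_norm_eq0 x : hermitian_norm x = 0 -> x = 0.
Proof.
move/eqP; rewrite sqrtr_eq0 => x0; apply/rowP => j; rewrite mxE.
have : \sum_j `|x 0 j| ^+ 2 == 0 by rewrite eq_le x0 sumsq_ge0.
rewrite psumr_eq0 => [|k _]; last exact: sqr_ge0.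
by move/allP/(_ j (mem_index_enum _)); rewrite /= sqrf_eq0 normr_eq0 => /eqP.
Qed.

HB.instance Definition _ := Lmodule_isNormed.Build R V
  hermitian_normD hermitian_normZ hermitian_norm_eq0.

End CvecNormedModule.

Section ComplexCalculus.
Variables (R : realType) (n : nat).

Definition basis_x (j : 'I_n) : Cvec R n := \row_k ((k == j)%:R : Rcomplex R).
Definition basis_y (j : 'I_n) : Cvec R n := \row_k ((k == j)%:R * ('i%C : Rcomplex R)).

(* [inl j] stands for x_j and [inr j] for y_j, where z_j = x_j + i y_j. *)
Definition real_basis (d : 'I_n + 'I_n) : Cvec R n :=
  match d with inl j => basis_x j | inr j => basis_y j end.

(* Iterated partial derivative of f in x_1, y_1, ..., x_n, y_n; the last entry
   of s is differentiated first. *)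
Definition iter_partial (W : normedModType R) (f : Cvec R n -> W)
    (s : seq ('I_n + 'I_n)) : Cvec R n -> W :=
  foldr (fun d g => 'D_(real_basis d) g) f s.

(* Meant for A open, where it says that f is C^oo on A: every iterated partial
   derivative is (Frechet, real) differentiable, hence continuous. The values of
   f outside A are irrelevant. *)
Definition smooth_on (W : normedModType R) (A : set (Cvec R n))
    (f : Cvec R n -> W) : Prop :=
  forall s z, A z -> differentiable (iter_partial f s) z.

(* sup over A of all partial derivatives of order <= r, as an extended real. *)
Definition Cr_norm (W : normedModType R) (r : nat) (A : set (Cvec R n))
    (f : Cvec R n -> W) : \bar R :=
  ereal_sup [set y | exists s z,
    [/\ (size s <= r)%N, A z & y = (`|iter_partial f s z|)%:E]].

(* The (0,1)-form (\bar\partial f)_z = \sum_j (d f / d \bar z_j) d \bar z_j,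
   given by its coefficients d f / d \bar z_j = (d f / d x_j + i d f / d y_j) / 2;
   its pointwise norm is the Hermitian norm of this vector. *)
Definition dbar (f : Cvec R n -> Rcomplex R) (z : Cvec R n) : Cvec R n :=
  \row_j (2^-1 * ('D_(basis_x j) f z + ('i%C : Rcomplex R) * 'D_(basis_y j) f z)).

End ComplexCalculus.

Definition op_norm (R : realType) (V W : normedModType R) (g : V -> W) : \bar R :=
  ereal_sup [set (`|g v|)%:E | v in [set v : V | `|v| <= 1]].

(* F is meant to be smooth, so that 'd F z is its real-linear differential. *)
Definition eta_transverse (R : realType) (V W : normedModType R) (eta : R)
    (B : set V) (F : V -> W) : Prop :=
  forall z, B z -> `|F z| < eta ->
    range ('d F z) = [set: W] /\
    exists2 g : {linear W -> V},
      cancel g ('d F z) & (op_norm g < (eta^-1)%:E)%E.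

(* Main.v *)
Require Import Defs.
From HB Require Import structures.
From mathcomp Require Import all_boot all_order all_algebra.
From mathcomp Require Import complex ring lra.
From mathcomp Require Import all_classical all_reals all_analysis.

Set Implicit Arguments.
Unset Strict Implicit.
Unset Printing Implicit Defensive.

Import Order.TTheory GRing.Theory Num.Theory.
Import numFieldNormedType.Exports.

Local Open Scope classical_set_scope.
Local Open Scope ring_scope.

(** Transversality of f - w_0 - sum w_i z_i to 0 can only fail at z when the
    value is at most eta and every coefficient dz_i f - w_i of its C-linear part
    is at most 2 eta: otherwise one coordinate direction already gives a right
    inverse, the C-antilinear part being bounded by eta ([right_inverse_of_gap]).
    So the bad w lie in the tube of width O(eta) around the set of points
    (f - sum z_i dz_i f, dz_1 f, ..., dz_n f)(z), and w has to be found in the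
    ball of radius delta outside this tube.

    That set is the image of a ball of C^n in C^(n+1), and the point is to
    control its complexity.  As dbar f is of size eta, f and its partial
    derivatives are polynomials of degree d = O(log (1 / eta)) up to O(eta).
    The approximation is a discrete Cauchy formula: averaging over the N points
    of a circle, for N huge, replaces integration, and the error is the defect
    of holomorphy ([discrete_cauchy_trunc]); in several variables the formula is
    applied to one variable after the other on a polydisc ([polydisc_approx]),
    and the unit ball is covered by a number of polydiscs depending only on n.

    A polynomial map from C^n to C^(n+1) of degree d takes its values in a
    hypersurface P = 0 of degree D = O(d^n), by counting dimensions
    ([algebraic_relation]).  Multiply the P of all the polydiscs.  Near a point
    of the ball where the modulus of this product is almost maximal, growth and
    coefficient bounds of one-variable polynomials show that it has no zero at
    distance less than delta / (8 D^2 (D + 1)), D being now the degree of the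
    product along complex lines ([polyfun_nonvanishing]).  This point is the
    required w as soon as O(eta) is smaller than that distance.  Since
    eta = delta (log (1 / delta))^(-p) while D is bounded by a power of
    p log (1 / delta) with exponent n, a large p suffices ([exists_degrees]). *)

(** * Complex numbers and roots of unity near 1 *)

Section ComplexNumbers.
Variable R : realType.
Local Notation C := (Rcomplex R).
Implicit Types x y z : C.

Lemma cnormM x y : `|x * y : C| = `|x| * `|y|.
Proof. exact: ComplexField.Normc.normcM. Qed.

Lemma cnorm1 : `|1 : C| = 1.
Proof. exact: ComplexField.Normc.normc1. Qed.

Lemma cnormV x : `|x^-1 : C| = `|x|^-1.
Proof. exact: ComplexField.Normc.normcV. Qed.

Lemma cnormX x k : `|x ^+ k : C| = `|x| ^+ k.
Proof. by elim: k => [|k IH]; rewrite ?cnorm1 // !exprS cnormM IH. Qed.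

Lemma cscalerAr (s : R) x y : s *: (x * y) = x * (s *: y).
Proof. by rewrite mulrC scalerAl mulrC. Qed.

Lemma cnorm_nat k : `|k%:R : C| = k%:R.
Proof. by rewrite normrMn cnorm1. Qed.

Lemma cnorm_prod (I : Type) (r : seq I) (P : pred I) (F : I -> C) :
  `|\prod_(i <- r | P i) F i : C| = \prod_(i <- r | P i) `|F i|.
Proof. by apply: (big_morph _ cnormM cnorm1). Qed.

Lemma cnorm_unity_root N x : (0 < N)%N -> x ^+ N = 1 -> `|x| = 1.
Proof.
move=> N0 xN; apply/eqP; rewrite -(@pexpr_eq1 _ _ N) ?normr_ge0 //.
by rewrite -cnormX xN cnorm1.
Qed.

Lemma sqr_cnorm x : `|x| ^+ 2 = complex.Re x ^+ 2 + complex.Im x ^+ 2.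
Proof.
case: x => a b; rewrite [`|_|]/(ComplexField.Normc.normc _) /= sqr_sqrtr //.
by rewrite addr_ge0 // sqr_ge0.
Qed.

Lemma norm_Re_le x : `|complex.Re x| <= `|x|.
Proof.
rewrite -(@ler_pXn2r _ 2) ?nnegrE ?normr_ge0 // sqr_cnorm real_normK ?num_real //.
by rewrite lerDl sqr_ge0.
Qed.

Lemma norm_Im_le x : `|complex.Im x| <= `|x|.
Proof.
rewrite -(@ler_pXn2r _ 2) ?nnegrE ?normr_ge0 // sqr_cnorm real_normK ?num_real //.
by rewrite lerDr sqr_ge0.
Qed.

Lemma cnorm_le_ReIm x : `|x| <= `|complex.Re x| + `|complex.Im x|.
Proof.
rewrite -(@ler_pXn2r _ 2) ?nnegrE ?normr_ge0 ?addr_ge0 // sqr_cnorm sqrrD.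
by rewrite !real_normK ?num_real // addrAC lerDl mulrn_wge0 ?mulr_ge0.
Qed.

(** Take iterated square roots of -1, always in the right half plane: each step
    divides the distance to 1 by |1 + x| >= sqrt 2 >= 5 / 4, and -1 being
    a power of each of them forces its order to be the full power of 2. *)
Lemma primitive_root_near1 (e : R) (m : nat) : 0 < e ->
  exists N, exists2 w : C, (m < N)%N & N.-primitive_root w /\ `|w - 1 : C| <= e.
Proof.
move=> e0; pose w k : C := iter k (@sqrtc R) (-1 : C).
have wS k : w k.+1 ^+ 2 = w k by exact: sqr_sqrtc.
have w2 k : w k ^+ (2 ^ k) = -1.
  by elim: k => [|k IH]; rewrite ?expr1 // expnS exprM wS.
have wprim k : (2 ^ k.+1).-primitive_root (w k).
  have w1 : w k ^+ (2 ^ k.+1) = 1 by rewrite expnSr exprM w2 sqrrN expr1n.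
  have [j jprim jd] := prim_order_exists (expn_gt0 2 k.+1) w1.
  move/(dvdn_pfactor _ _ (isT : prime 2)): jd => [i ik jE].
  move: ik; rewrite leq_eqVlt => /orP[/eqP <-|]; first by rewrite -jE.
  rewrite ltnS => ik; have := w2 k.
  have -> : (2 ^ k = j * 2 ^ (k - i))%N by rewrite jE -expnD subnKC.
  rewrite exprM (prim_expr_order jprim) expr1n.
  move/(congr1 (@complex.Re R)) => /= h.
  by exfalso; move: h; lra.
have wn k : `|w k| = 1.
  by apply: cnorm_unity_root (prim_expr_order (wprim k)); rewrite expn_gt0.
have wRe k : 0 <= complex.Re (w k.+1).
  by rewrite [w _]/(sqrtc (w k)); case: (w k) => a b; exact: sqrtr_ge0.
have wd k : `|w k.+1 - 1 : C| * (5 / 4) <= `|w k - 1 : C|.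
  have -> : w k - 1 = (w k.+1 - 1) * (w k.+1 + 1).
    by rewrite -subr_sqr expr1n wS.
  rewrite cnormM ler_wpM2l //.
  rewrite -(@ler_pXn2r _ 2) ?nnegrE // ?divr_ge0 //.
  rewrite sqr_cnorm; have := sqr_cnorm (w k.+1); rewrite wn; have := wRe k.
  case: (w k.+1) => a b /= a0; rewrite addr0 sqrrD !expr1n mulr1. lra.
have wd' k : `|w k - 1 : C| * (5 / 4) ^+ k <= 2.
  elim: k => [|k IH].
    rewrite mulr1; apply: le_trans (ler_normB _ _) _.
    by rewrite wn cnorm1; lra.
  rewrite exprS mulrA; apply: le_trans IH.
  by rewrite ler_wpM2r // exprn_ge0.
have [k hk] : exists k : nat, 2 / e <= (5 / 4) ^+ (m + k).
  have [k hk] : exists k : nat, 8 / e <= k%:R.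
    exists (Num.bound (8 / e)); apply/ltW/archi_boundP.
    by rewrite divr_ge0 // ltW.
  exists k; have B j : 1 + j%:R / 4 <= ((5 / 4) ^+ j : R).
    elim: j => [|j IH]; first by rewrite mul0r addr0.
    rewrite exprS -natr1; have : 0 <= j%:R :> R by []. nra.
  apply: le_trans (B _); rewrite natrD; have : 0 <= m%:R :> R by [].
  have -> : 2 / e = (8 / e) / 4 by field; rewrite gt_eqF.
  lra.
exists (2 ^ (m + k).+1)%N, (w (m + k)%N); last split => //.
  apply: leq_trans (ltn_expl m (isT : 1 < 2)%N) _.
  by rewrite leq_exp2l // leqW // leq_addr.
have p0 : 0 < (5 / 4) ^+ (m + k) :> R by rewrite exprn_gt0 //; lra.
rewrite -(ler_pM2r p0); apply: le_trans (wd' _) _.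
by rewrite mulrC -ler_pdivrMr.
Qed.

End ComplexNumbers.

(** * A discrete Cauchy formula for nearly holomorphic functions *)

Section GeometricSum.
Variable R : realType.
Local Notation C := (Rcomplex R).

Lemma geometric_sum_le (x : C) k l : `|x| <= 2^-1 ->
  \sum_(k <= i < k + l) `|x ^+ i : C| <= 2 / 2 ^+ k.
Proof.
move=> x2; elim: l k => [|l IH] k.
  by rewrite addn0 big_geq // divr_ge0 // exprn_ge0.
rewrite big_ltn; last by rewrite addnS ltnS leq_addr.
rewrite addnS -addSn; apply: le_trans (lerD (lexx _) (IH _)) _.
rewrite cnormX exprS invfM mulrA divff ?pnatr_eq0 // mul1r.
have : `|x| ^+ k <= 2^-1 ^+ k by rewrite lerXn2r ?nnegrE ?invr_ge0.
rewrite exprVn; lra.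
Qed.

End GeometricSum.

(** In [phi_taylor], e measures how far phi is from being complex differentiable
    with derivative a, and it enters the final error; K only enters multiplied
    by the mesh of the subdivisions, which can be taken as small as wanted. *)
Section DiscreteCauchyFormula.
Variable R : realType.
Local Notation C := (Rcomplex R).
Variables (N : nat) (w c rho z : C) (r e K : R) (phi a : C -> C).
Hypothesis N1 : (1 < N)%N.
Hypothesis wN : N.-primitive_root w.
Hypothesis rhoE : `|rho| = r.
Hypothesis r0 : 0 < r.
Hypotheses (e0 : 0 <= e) (K0 : 0 <= K).
Hypothesis zr : `|z - c : C| <= r.
Hypothesis phi_taylor : forall x y : C, `|x - c : C| <= r -> `|y - c : C| <= r ->
  `|phi y - phi x - a x * (y - x) : C| <= e * `|y - x : C| + K * `|y - x : C| ^+ 2.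

Let N0 : (0 < N)%N. Proof. exact: prim_order_gt0 wN. Qed.
Let wNE : w ^+ N = 1. Proof. exact: prim_expr_order wN. Qed.
Let w1 : `|w| = 1. Proof. exact: cnorm_unity_root N0 wNE. Qed.
Let wX k : `|w ^+ k : C| = 1. Proof. by rewrite cnormX w1 expr1n. Qed.
Let w0 : w != 0.
Proof. by rewrite -normr_eq0 w1 oner_eq0. Qed.
Let rho0 : rho != 0.
Proof. by rewrite -normr_eq0 rhoE gt_eqF. Qed.

Definition circle_pt (j : nat) : C := c + rho * w ^+ j.

(** As s decreases from 1 to 0, the circle formed by these points shrinks from
    the circle of radius r to the point z, without leaving the disc. *)
Definition ray (s : R) (j : nat) : C :=
  c + ((1 - s) *: (z - c) + s *: (rho * w ^+ j)).

(** The geometric expansion of (y - c) / (y - z) at the sample point y, cut at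
    degree d; for d = N it is that quotient times a factor independent of j. *)
Definition cauchy_kernel (d j : nat) : C :=
  \sum_(k < d) ((z - c) / (rho * w ^+ j)) ^+ k.

Definition cauchy_mean (d : nat) (s : R) : C :=
  \sum_(j < N) phi (ray s j) * cauchy_kernel d j.

Let ray0 j : ray 0 j = z.
Proof. by rewrite /ray subr0 scale1r scale0r addr0 addrC subrK. Qed.

Let ray1 j : ray 1 j = circle_pt j.
Proof. by rewrite /ray subrr scale1r scale0r add0r. Qed.

Let ray_disc (s : R) j : 0 <= s <= 1 -> `|ray s j - c : C| <= r.
Proof.
move=> /andP[s0 s1]; rewrite /ray [c + _]addrC addrK.
apply: le_trans (ler_normD _ _) _.
rewrite !normrZ cnormM wX rhoE mulr1 ger0_norm ?subr_ge0 // ger0_norm //.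
have : (1 - s) * `|z - c : C| <= (1 - s) * r by rewrite ler_wpM2l // subr_ge0.
lra.
Qed.

Let sum_wX k : (0 < k < N)%N -> \sum_(j < N) (w ^+ k) ^+ j = 0.
Proof.
move=> /andP[k0 kN].
have wk1 : w ^+ k - 1 != 0.
  by rewrite subr_eq0 -(prim_order_dvd wN) gtnNdvd.
apply: (mulfI wk1); rewrite mulr0 -subrX1 -exprM mulnC exprM wNE.
by rewrite expr1n subrr.
Qed.

(** Going round the circle of radius s r, the increments of phi telescope to
    zero, so the holomorphic part of its differential nearly sums to zero. *)
Lemma sum_dphi_circle (s : R) : 0 <= s <= 1 ->
  `|\sum_(j < N) a (ray s j) * (rho * w ^+ j) : C|
    <= N%:R * (e * r + K * r ^+ 2 * `|w - 1 : C|).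
Proof.
move=> s01; have /andP[s0 s1] := s01.
set S := (X in `|X|).
have [s00|sn0] := eqVneq s 0.
  have -> : S = 0.
    rewrite /S (eq_bigr (fun j : 'I_N => (a z * rho) * (w ^+ 1) ^+ j)).
      by rewrite -mulr_sumr sum_wX ?mulr0.
    by move=> j _; rewrite s00 ray0 expr1 mulrA.
  by rewrite normr0 !(mulr_ge0, addr_ge0, exprn_ge0, ler0n) // ltW.
have spos : 0 < s by rewrite lt_def sn0.
have raySB j : ray s j.+1 - ray s j = s *: (rho * w ^+ j * (w - 1)).
  rewrite /ray opprD addrACA subrr add0r opprD addrACA subrr add0r -scalerBr.
  by rewrite mulrBr mulr1 exprSr mulrA.
have tel : \sum_(j < N) (phi (ray s j.+1) - phi (ray s j)) = 0.
  rewrite -(big_mkord xpredT (fun j => phi (ray s j.+1) - phi (ray s j))).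
  rewrite telescope_sumr //.
  by rewrite /ray wNE expr0 subrr.
have E : s *: ((w - 1) * S) = - \sum_(j < N)
    (phi (ray s j.+1) - phi (ray s j) - a (ray s j) * (ray s j.+1 - ray s j)).
  rewrite sumrB tel sub0r opprK mulr_sumr scaler_sumr; apply: eq_bigr => j _.
  rewrite raySB -cscalerAr; congr (_ *: _); ring.
have d0 : 0 < `|w - 1 : C|.
  by rewrite normr_gt0 subr_eq0 -[w]expr1 -(prim_order_dvd wN) gtnNdvd.
rewrite -(ler_pM2l (mulr_gt0 spos d0)).
have -> : s * `|w - 1 : C| * `|S : C| = `|s *: ((w - 1) * S) : C|.
  by rewrite normrZ cnormM ger0_norm // mulrA.
rewrite E normrN; apply: le_trans (ler_norm_sum _ _ _) _.
pose B := e * (s * r * `|w - 1 : C|) + K * (s * r * `|w - 1 : C|) ^+ 2.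
apply: (@le_trans _ _ (\sum_(j < N) B)).
  apply: ler_sum => j _; apply: le_trans (phi_taylor _ _) _; rewrite ?ray_disc //.
  by rewrite raySB normrZ !cnormM wX rhoE mulr1 ger0_norm // mulrA.
rewrite sumr_const card_ord -[leLHS]mulr_natl /B [leRHS]mulrCA. rewrite ler_pM2l ?ltr0n //.
have -> : K * (s * r * `|w - 1 : C|) ^+ 2 =
  (s * `|w - 1 : C|) * (K * r ^+ 2 * `|w - 1 : C|) * s by ring.
rewrite [leRHS]mulrDr lerD //; first by rewrite le_eqVlt; apply/orP; left; apply/eqP; ring.
by rewrite ler_piMr // !(mulr_ge0, exprn_ge0) // ltW.
Qed.

Let kernelE j : (circle_pt j - z) * cauchy_kernel N j =
  rho * w ^+ j * (1 - ((z - c) / rho) ^+ N).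
Proof.
have wj0 : rho * w ^+ j != 0 by rewrite mulf_neq0 ?expf_neq0.
rewrite /cauchy_kernel; set x := _ / (_ * _).
have -> : circle_pt j - z = - (rho * w ^+ j) * (x - 1).
  have xE : (rho * w ^+ j) * x = z - c by rewrite mulrC divfK.
  by rewrite /circle_pt mulrBr mulr1 opprK mulNr xE; ring.
rewrite mulNr mulNr -mulrA -subrX1 -mulrN opprB; congr (_ * (1 - _)).
rewrite /x invfM mulrA exprMn exprVn -exprM mulnC exprM wNE expr1n invr1.
by rewrite mulr1.
Qed.

(** The derivative of the mean in s is, up to a constant factor, the sum of
    [sum_dphi_circle]: the kernel turns the velocity y - z of the sample point
    into y - c.  Hence the mean hardly moves during the shrinking. *)
Lemma cauchy_mean_step (s s' : R) : 0 <= s <= 1 -> 0 <= s' <= 1 -> s <= s' ->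
  `|cauchy_mean N s' - cauchy_mean N s : C| <= N%:R *
    ((s' - s) * (4 * (e * r) + 2 * (K * r ^+ 2 * `|w - 1 : C|))
     + 4 * (K * r ^+ 2) * (s' - s) ^+ 2).
Proof.
move=> s01 s01' ss'; set t := s' - s; have t0 : 0 <= t by rewrite subr_ge0.
set X := 1 - ((z - c) / rho) ^+ N.
have X2 : `|X : C| <= 2.
  apply: le_trans (ler_normB _ _) _; rewrite cnorm1 cnormX cnormM cnormV rhoE.
  have : (`|z - c : C| / r) ^+ N <= 1.
    by rewrite exprn_ile1 ?divr_ge0 ?(ltW r0) // ler_pdivrMr // mul1r.
  lra.
have rayB j : ray s' j - ray s j = t *: (circle_pt j - z).
  rewrite /ray opprD addrACA subrr add0r opprD addrACA -!scalerBl.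
  have -> : 1 - s' - (1 - s) = - t by rewrite /t; ring.
  rewrite scaleNr -scalerN -scalerDr /circle_pt; congr (_ *: _); ring.
set D := fun j => phi (ray s' j) - phi (ray s j) - a (ray s j) * (ray s' j - ray s j).
have -> : cauchy_mean N s' - cauchy_mean N s =
   t *: (X * \sum_(j < N) a (ray s j) * (rho * w ^+ j))
   + \sum_(j < N) D j * cauchy_kernel N j.
  rewrite /cauchy_mean -sumrB mulr_sumr scaler_sumr -big_split /=.
  apply: eq_bigr => j _; rewrite /D rayB.
  have -> : X * (a (ray s j) * (rho * w ^+ j)) =
     a (ray s j) * ((circle_pt j - z) * cauchy_kernel N j).
    by rewrite kernelE /X; ring.
  by rewrite -cscalerAr [X in _ = _ + X]mulrBl -scalerAl -mulrA [RHS]addrC subrK mulrBl.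
apply: le_trans (ler_normD _ _) _.
rewrite normrZ cnormM (ger0_norm t0).
have h1 := sum_dphi_circle s01.
set S := \sum_(j < N) a _ * _ in h1 *.
have h1' : t * (`|X : C| * `|S : C|) <=
    t * (2 * (N%:R * (e * r + K * r ^+ 2 * `|w - 1 : C|))).
  by rewrite ler_wpM2l // ler_pM.
have h2 : `|\sum_(j < N) D j * cauchy_kernel N j : C| <=
    N%:R * (2 * (e * r) * t + 4 * (K * r ^+ 2) * t ^+ 2).
  apply: le_trans (ler_norm_sum _ _ _) _.
  rewrite -[N in N%:R]card_ord [leRHS]mulr_natl -sumr_const; apply: ler_sum => j _.
  have ck : `|circle_pt j - z : C| * `|cauchy_kernel N j| <= 2 * r.
    rewrite -cnormM kernelE !cnormM wX rhoE mulr1 mulrC ler_wpM2r //.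
    exact: ltW.
  have c2 : `|circle_pt j - z : C| <= 2 * r.
    have -> : circle_pt j - z = rho * w ^+ j - (z - c) by rewrite /circle_pt; ring.
    apply: le_trans (ler_normB _ _) _; by rewrite cnormM wX rhoE mulr1 mulr_natl mulr2n lerD2l.
  rewrite cnormM; have hD := phi_taylor (ray_disc j s01) (ray_disc j s01').
  rewrite rayB normrZ (ger0_norm t0) in hD.
  apply: le_trans (ler_wpM2r (normr_ge0 _) _) _; first by rewrite /D rayB; exact: hD.
  rewrite mulrDl lerD //.
    have -> : e * (t * `|circle_pt j - z : C|) * `|cauchy_kernel N j|
      = (e * t) * (`|circle_pt j - z : C| * `|cauchy_kernel N j|) by ring.
    have -> : 2 * (e * r) * t = (e * t) * (2 * r) by ring.
    by rewrite ler_wpM2l // mulr_ge0.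
  have -> : K * (t * `|circle_pt j - z : C|) ^+ 2 * `|cauchy_kernel N j| = (K * t ^+ 2) *
     (`|circle_pt j - z : C| * (`|circle_pt j - z : C| * `|cauchy_kernel N j|)) by ring.
  have -> : 4 * (K * r ^+ 2) * t ^+ 2 = (K * t ^+ 2) * ((2 * r) * (2 * r)) by ring.
  rewrite ler_wpM2l ?mulr_ge0 ?exprn_ge0 // ler_pM // mulr_ge0 //.
apply: le_trans (lerD h1' h2) _.
by rewrite le_eqVlt; apply/orP; left; apply/eqP; ring.
Qed.

Lemma cauchy_mean0 : cauchy_mean N 0 = N%:R * phi z.
Proof.
rewrite /cauchy_mean.
under eq_bigr do rewrite ray0.
rewrite -mulr_sumr mulrC; congr (_ * _).
rewrite exchange_big /= (bigD1 (Ordinal N0)) //= [X in _ + X]big1 ?addr0.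
  by under eq_bigr do rewrite expr0; rewrite sumr_const card_ord.
move=> k kn0; have kN : (0 < k < N)%N by rewrite lt0n kn0 ltn_ord.
have [x0|zc0] := eqVneq (z - c) 0.
  by apply: big1 => j _; rewrite x0 mul0r expr0n -[k == _ :> nat]/(k == Ordinal N0) (negPf kn0).
have -> : \sum_(i < N) ((z - c) / (rho * w ^+ i)) ^+ k =
   ((z - c) / rho) ^+ k * \sum_(i < N) (w ^+ (N - k)) ^+ i.
  rewrite mulr_sumr; apply: eq_bigr => j _; rewrite invfM mulrA exprMn; congr (_ * _).
  apply: (mulfI (expf_neq0 k (expf_neq0 j w0))).
  rewrite exprVn mulfV ?expf_neq0 // -!exprM -exprD mulnC -mulnDl subnKC; last first.
    by case/andP: kN => _ /ltnW.
  by rewrite exprM wNE expr1n.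
rewrite sum_wX ?mulr0 //.
case/andP: kN => k0 kN; rewrite subn_gt0 kN ltn_subrL k0 //=.
Qed.

Lemma discrete_cauchy (m : nat) :
  `|cauchy_mean N 1 - N%:R * phi z : C| <= N%:R *
    (4 * (e * r) + 2 * (K * r ^+ 2 * `|w - 1 : C|) + 4 * (K * r ^+ 2) / m.+1%:R).
Proof.
rewrite -cauchy_mean0; pose s (k : nat) : R := k%:R / m.+1%:R.
have m0 : 0 < m.+1%:R :> R by rewrite ltr0n.
have s01 k : (k <= m.+1)%N -> 0 <= s k <= 1.
  by move=> km; rewrite /s divr_ge0 //= ler_pdivrMr // mul1r ler_nat.
have -> : cauchy_mean N 1 - cauchy_mean N 0 =
    \sum_(0 <= k < m.+1) (cauchy_mean N (s k.+1) - cauchy_mean N (s k)).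
  rewrite (telescope_sumr (cauchy_mean N \o s)) //= /s mul0r divff //.
rewrite big_mkord; apply: le_trans (ler_norm_sum _ _ _) _.
set B := 4 * (e * r) + _; pose t : R := m.+1%:R^-1.
apply: (@le_trans _ _
  (\sum_(k < m.+1) N%:R * (t * B + 4 * (K * r ^+ 2) * t ^+ 2))).
  apply: ler_sum => k _.
  have st : s k.+1 - s k = t by rewrite /s -mulrBl -natr1 addrC addKr mul1r.
  apply: le_trans (cauchy_mean_step _ _ _) _; rewrite ?s01 ?st //.
  - by rewrite ltnW.
  - by rewrite -subr_ge0 st invr_ge0.
rewrite sumr_const card_ord -[leLHS]mulr_natl /t.
rewrite le_eqVlt; apply/orP; left; apply/eqP.
by move: (m.+1%:R : R) (lt0r_neq0 m0) => T T0; field.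
Qed.

(** Cutting the kernel at degree d turns the discrete Cauchy formula into an
    approximation of phi by a polynomial in z. *)
Lemma discrete_cauchy_trunc (d m : nat) (M : R) : (d <= N)%N ->
  (forall y : C, `|y - c : C| <= r -> `|phi y| <= M) ->
  `|z - c : C| <= r / 2 ->
  `|phi z - N%:R^-1 * (\sum_(j < N) phi (circle_pt j) * cauchy_kernel d j) : C|
  <= 4 * (e * r) + 2 * (K * r ^+ 2 * `|w - 1 : C|) + 4 * (K * r ^+ 2) / m.+1%:R
     + 2 * M / 2 ^+ d.
Proof.
move=> dN phiM zr2.
have NC0 : (N%:R : C) != 0 by rewrite -normr_eq0 cnorm_nat pnatr_eq0 -lt0n.
have M0 : 0 <= M by apply: le_trans (phiM c _); rewrite // subrr normr0 ltW.
have NR0 : 0 < N%:R :> R by rewrite ltr0n.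
rewrite -(ler_pM2l NR0).
have -> : N%:R * `|phi z - N%:R^-1 * (\sum_(j < N) phi (circle_pt j) * cauchy_kernel d j) : C|
  = `|N%:R * phi z - cauchy_mean d 1 : C|.
  rewrite -[N%:R in LHS]cnorm_nat -cnormM mulrBr mulrA mulfV // mul1r.
  congr (`|_ - _ : C|); apply: eq_bigr => j _; by rewrite ray1.
have -> : N%:R * phi z - cauchy_mean d 1 =
  (N%:R * phi z - cauchy_mean N 1) + (cauchy_mean N 1 - cauchy_mean d 1) by ring.
apply: le_trans (ler_normD _ _) _; rewrite mulrDr lerD //.
  by rewrite distrC; exact: discrete_cauchy.
rewrite /cauchy_mean -sumrB; apply: le_trans (ler_norm_sum _ _ _) _.
rewrite -[N in N%:R]card_ord [leRHS]mulr_natl -sumr_const; apply: ler_sum => j _.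
rewrite -mulrBr cnormM.
apply: (@le_trans _ _ (M * (2 / 2 ^+ d))); last by rewrite mulrA [M * 2]mulrC.
rewrite ler_pM //; first by rewrite ray1 phiM // -ray1 ray_disc // ler01 lexx.
rewrite /cauchy_kernel; set x := _ / (_ * _).
have x2 : `|x : C| <= 2^-1.
  rewrite /x cnormM cnormV cnormM wX rhoE mulr1 ler_pdivrMr //.
  by rewrite mulrC.
rewrite -(big_mkord xpredT (fun k => x ^+ k)) -(big_mkord xpredT (fun k => x ^+ k)).
rewrite (big_cat_nat _ dN) //= [X in X - _]addrC addrK.
apply: le_trans (ler_norm_sum _ _ _) _.
by have := geometric_sum_le d (N - d) x2; rewrite subnKC.
Qed.

End DiscreteCauchyFormula.

(** * Polynomial approximation on polydiscs *)

Section PolynomialFunctions.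
Variables (R : realType) (n : nat).
Local Notation C := (Rcomplex R).
Local Notation V := (Cvec R n).
Implicit Types (z : V) (F G : V -> C).

Definition monomial (al : 'I_n -> nat) (z : V) : C := \prod_i (z 0 i) ^+ al i.

(** The degree is bounded in each variable separately: the bounds add under
    products, and the space has the explicit dimension (e + 1)^n. *)
Definition polyfun (e : nat) F := exists k : {ffun 'I_n -> 'I_e.+1} -> C,
  forall z, F z = \sum_al k al * monomial (fun i => al i) z.

Lemma eq_polyfun e F G : F =1 G -> polyfun e F -> polyfun e G.
Proof. by move=> FG [k kE]; exists k => z; rewrite -FG. Qed.

Lemma polyfun_monomial e al : (forall i, al i <= e)%N -> polyfun e (monomial al).
Proof.
move=> ale; pose b := [ffun i : 'I_n => inord (al i) : 'I_e.+1].
exists (fun ga => (ga == b)%:R) => z.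
rewrite (bigD1 b) //= eqxx mul1r big1 ?addr0 => [|ga /negPf ->]; last by rewrite mul0r.
by apply: eq_bigr => i _; rewrite ffunE inordK // ltnS.
Qed.

Lemma polyfun0 e : polyfun e (fun=> 0).
Proof. by exists (fun=> 0) => z; rewrite big1 // => ga _; rewrite mul0r. Qed.

Lemma polyfunD e F G : polyfun e F -> polyfun e G -> polyfun e (fun z => F z + G z).
Proof.
move=> [k kE] [l lE]; exists (fun ga => k ga + l ga) => z.
by rewrite kE lE -big_split; apply: eq_bigr => ga _; rewrite mulrDl.
Qed.

Lemma polyfunZ e (c : C) F : polyfun e F -> polyfun e (fun z => c * F z).
Proof.
move=> [k kE]; exists (fun ga => c * k ga) => z.
by rewrite kE mulr_sumr; apply: eq_bigr => ga _; rewrite mulrA.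
Qed.

Lemma polyfun_sum e (I : Type) (s : seq I) (P : pred I) (F : I -> V -> C) :
  (forall i, polyfun e (F i)) -> polyfun e (fun z => \sum_(i <- s | P i) F i z).
Proof.
move=> FP; elim: s => [|i s IH].
  by apply: eq_polyfun (polyfun0 e) => z; rewrite big_nil.
have [Pi|Pi] := boolP (P i).
  by apply: eq_polyfun (polyfunD (FP i) IH) => z; rewrite big_cons Pi.
by apply: eq_polyfun IH => z; rewrite big_cons (negPf Pi).
Qed.

Lemma polyfunM e e' F G : polyfun e F -> polyfun e' G ->
  polyfun (e + e') (fun z => F z * G z).
Proof.
move=> [k kE] [l lE].
apply: (@eq_polyfun _ (fun z => \sum_ga \sum_de (k ga * l de) *
    monomial (fun i => (ga i + de i)%N) z)).
  move=> z; rewrite kE lE mulr_suml; apply: eq_bigr => ga _.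
  rewrite mulr_sumr; apply: eq_bigr => de _; rewrite mulrACA; congr (_ * _).
  by rewrite -big_split; apply: eq_bigr => i _; rewrite exprD.
do 2![apply: polyfun_sum => ?]; apply: polyfunZ; apply: polyfun_monomial => i.
by rewrite leq_add // -ltnS.
Qed.

Lemma polyfun_cst e (c : C) : polyfun e (fun=> c).
Proof.
apply: (@eq_polyfun _ (fun z => c * monomial (fun=> 0%N) z)).
  by move=> z; rewrite /monomial big1 ?mulr1.
exact/polyfunZ/polyfun_monomial.
Qed.

Lemma polyfun_coord (i : 'I_n) : polyfun 1 (fun z => z 0 i).
Proof.
apply: (@eq_polyfun _ (monomial (fun j => (j == i)%N))); last first.
  by apply: polyfun_monomial => j; case: eqP.
move=> z; rewrite /monomial (bigD1 i) //= eqxx expr1 big1 ?mulr1 // => j /negPf ->.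
by rewrite expr0.
Qed.

Lemma polyfunW e e' F : (e <= e')%N -> polyfun e F -> polyfun e' F.
Proof.
move=> ee' [k kE].
apply: (@eq_polyfun _ (fun z => \sum_ga k ga * monomial (fun i => ga i) z)) => //.
apply: polyfun_sum => ga; apply: polyfunZ; apply: polyfun_monomial => i.
by apply: leq_trans ee'; rewrite -ltnS.
Qed.

Lemma polyfunX e F k : polyfun e F -> polyfun (k * e) (fun z => F z ^+ k).
Proof.
move=> FP; elim: k => [|k IH]; first exact: polyfun_cst.
by apply: eq_polyfun (polyfunM FP IH) => z; rewrite exprS.
Qed.

Lemma polyfun_prod (I : Type) (s : seq I) (e : I -> nat) (F : I -> V -> C) :
  (forall i, polyfun (e i) (F i)) ->
  polyfun (\sum_(i <- s) e i) (fun z => \prod_(i <- s) F i z).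
Proof.
move=> FP; elim: s => [|i s IH].
  by apply: eq_polyfun (polyfun_cst _ 1) => z; rewrite big_nil.
rewrite big_cons.
by apply: eq_polyfun (polyfunM (FP i) IH) => z; rewrite big_cons.
Qed.

End PolynomialFunctions.

Section PolydiscApproximation.
Variables (R : realType) (n : nat).
Local Notation C := (Rcomplex R).
Local Notation V := (Cvec R n).

Definition upd (z : V) (i : 'I_n) (x : C) : V :=
  \row_k (if k == i then x else z 0 k).

Definition polydisc (c : V) (r : R) (z : V) := forall i, `|z 0 i - c 0 i : C| <= r.

Variables (c : V) (r : R) (h : V -> C) (a : 'I_n -> V -> C) (e K M : R).
Hypotheses (r0 : 0 < r) (e0 : 0 < e) (K0 : 0 <= K).
Hypothesis hM : forall z, polydisc c (2 * r) z -> `|h z| <= M.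
Hypothesis h_taylor : forall i z (x y : C), polydisc c (2 * r) z ->
  `|x - c 0 i : C| <= 2 * r -> `|y - c 0 i : C| <= 2 * r ->
  `|h (upd z i y) - h (upd z i x) - a i (upd z i x) * (y - x) : C|
     <= e * `|y - x : C| + K * `|y - x : C| ^+ 2.

(** Used to say that a function is polynomial in its first m variables, the
    others being frozen. *)
Let mix (m : nat) (z z0 : V) : V := \row_i (if (i < m)%N then z 0 i else z0 0 i).

(** Near-holomorphic functions are polynomial up to an error proportional to
    their defect e.  The discrete Cauchy formula is applied to the variables
    one after the other; as the sampled function may be evaluated on the big
    circle in the later variables, closeness is only kept on the product of
    small discs (variables already treated) and big discs (the others). *)
Lemma polydisc_approx (d : nat) :
  exists2 g : V -> C, polyfun (n * d) g &
    forall z, polydisc c r z ->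
      `|h z - g z : C| <= 2 ^+ n * (12 * (e * r) + 2 * M / 2 ^+ d).
Proof.
have M0 : 0 <= M.
  apply: le_trans (hM (z := c) _); rewrite // => i.
  by rewrite subrr normr0 mulr_ge0 // ltW.
pose r2 := 2 * r; have r20 : 0 < r2 by rewrite mulr_gt0.
have eps0 : 0 < e / (2 * ((K + 1) * r2)).
  by rewrite !(divr_gt0, mulr_gt0) // ltr_wpDl.
have [N [w dN [wN w1]]] := primitive_root_near1 d.+1 eps0.
have N1 : (1 < N)%N by apply: leq_trans dN.
have [m hm] : exists m : nat, 4 * (K * r2) / e <= m%:R.
  exists (Num.bound (4 * (K * r2) / e)); apply/ltW/archi_boundP.
  by rewrite !(divr_ge0, mulr_ge0) // ltW.
pose e1 := 12 * (e * r) + 2 * M / 2 ^+ d.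
have e10 : 0 <= e1.
  by rewrite addr_ge0 // !(divr_ge0, mulr_ge0, exprn_ge0) // ltW.
pose rho : C := r2%:A; have rhoE : `|rho| = r2.
  by rewrite normrZ cnorm1 mulr1 ger0_norm // ltW.
pose T (i : 'I_n) (U : V -> C) z : C := N%:R^-1 * \sum_(j < N)
  U (upd z i (circle_pt w (c 0 i) rho j)) * cauchy_kernel w (c 0 i) rho (z 0 i) d j.
have w_1 : `|w| = 1.
  by apply: cnorm_unity_root (prim_expr_order wN); apply: ltn_trans N1.
have circ (i : 'I_n) j : `|circle_pt w (c 0 i) rho j - c 0 i : C| <= r2.
  by rewrite /circle_pt addrC addKr cnormM rhoE cnormX w_1 expr1n mulr1.
have Th (i : 'I_n) (z : V) : polydisc c r2 z -> `|z 0 i - c 0 i : C| <= r ->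
    `|h z - T i h z : C| <= e1.
  move=> zP zi.
  have updz : upd z i (z 0 i) = z.
    by apply/rowP => k; rewrite mxE; case: eqP => [->|].
  have := @discrete_cauchy_trunc R N w (c 0 i) rho (z 0 i) r2 e K
    (fun x => h (upd z i x)) (fun x => a i (upd z i x)) N1 wN rhoE r20
    (ltW e0) K0 (zP i) _ d m M (ltnW (ltnW dN)) _ _.
  rewrite updz => H; apply: le_trans (H _ _ _) _.
  - by move=> x y; exact: h_taylor.
  - move=> y yr; apply: hM => k; rewrite mxE; case: eqP => [->//|_]; exact: zP.
  - by rewrite /r2 mulrC mulKf.
  rewrite /e1 lerD2r.
  have Kw : K * r2 * `|w - 1 : C| <= e / 2.
    apply: (@le_trans _ _ ((K + 1) * r2 * (e / (2 * ((K + 1) * r2))))).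
      apply: ler_pM => //; first by rewrite mulr_ge0 // ltW.
      by apply: ler_wpM2r; rewrite ?lerDl // ltW.
    rewrite le_eqVlt; apply/orP; left; apply/eqP; field.
    by rewrite !gt_eqF // ltr_wpDl.
  have Km : 4 * (K * r2) / m.+1%:R <= e.
    rewrite ler_pdivrMr ?ltr0n // [leRHS]mulrC -ler_pdivrMr //.
    by apply: le_trans hm _; rewrite ler_nat.
  have -> : 4 * (e * r2) + 2 * (K * r2 ^+ 2 * `|w - 1 : C|) + 4 * (K * r2 ^+ 2) / m.+1%:R
   = r2 * (4 * e + 2 * (K * r2 * `|w - 1 : C|) + 4 * (K * r2) / m.+1%:R) by ring.
  have -> : 12 * (e * r) = r2 * (6 * e) by rewrite /r2; ring.
  apply: ler_wpM2l; first exact: ltW.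
  move: Kw Km; set A := K * r2 * _; set B := _ / m.+1%:R; lra.
(* T has norm at most 2, the kernel being a partial geometric sum of ratio at
   most 1 / 2; so an error E becomes 2 E + e1 at the next variable. *)
have TB (i : 'I_n) (U U' : V -> C) (z : V) (b : R) : `|z 0 i - c 0 i : C| <= r ->
    (forall x : C, `|x - c 0 i : C| <= r2 -> `|U (upd z i x) - U' (upd z i x) : C| <= b) ->
    `|T i U z - T i U' z : C| <= b * 2.
  move=> zi UU; rewrite /T -mulrBr -sumrB cnormM cnormV cnorm_nat.
  rewrite ler_pdivrMl ?ltr0n ?(ltn_trans _ N1) //.
  apply: le_trans (ler_norm_sum _ _ _) _.
  rewrite -[N in N%:R]card_ord [leRHS]mulr_natl -sumr_const; apply: ler_sum => j _.
  rewrite -mulrBl cnormM ler_pM //; first exact: UU.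
  rewrite /cauchy_kernel; set x : C := _ / (_ * _).
  have x2 : `|x| <= 2^-1.
    rewrite /x cnormM cnormV cnormM cnormX w_1 expr1n rhoE mulr1 ler_pdivrMr //.
    by rewrite /r2 mulKf.
  apply: le_trans (ler_norm_sum _ _ _) _.
  rewrite -(big_mkord xpredT (fun k => `|x ^+ k : C|)).
  by have := geometric_sum_le 0 d x2; rewrite add0n expr0 divr1.
have step k : (k <= n)%N -> exists2 g : V -> C,
    (forall z0, polyfun (k * d) (fun z => g (mix k z z0))) &
    forall z : V, (forall i : 'I_n, `|z 0 i - c 0 i : C| <= if (i < k)%N then r else r2) ->
      `|h z - g z : C| <= (2 ^+ k - 1) * e1; last first.
  have [g gP gh] := step n (leqnn n); exists g.
    apply: (eq_polyfun _ (gP 0)) => z; congr g; apply/rowP => i.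
    by rewrite mxE ltn_ord.
  move=> z zP; apply: le_trans (gh z _) _; first by move=> i; rewrite ltn_ord.
  by rewrite ler_wpM2r // gerBl.
elim: k => [|k IH] kn.
  exists h => [z0|z zP].
    apply: (eq_polyfun _ (@polyfun_cst R n _ (h z0))) => z; congr h; apply/rowP => i.
    by rewrite mxE.
  by rewrite subrr normr0 expr0 subrr mul0r.
have [g gP gh] := IH (ltnW kn); pose i0 := Ordinal kn.
exists (T i0 g) => [z0|z zP].
  have xP j : polyfun d (fun z => cauchy_kernel w (c 0 i0) rho (mix k.+1 z z0 0 i0) d j).
    apply: polyfun_sum => l; apply: (@polyfunW _ _ (l * 1)).
      by rewrite muln1 ltnW.
    apply: polyfunX.
    apply: (@eq_polyfun _ _ _ (fun z => (rho * w ^+ j)^-1 * (z 0 i0 + - c 0 i0))).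
      by move=> z; rewrite mulrC mxE ltnSn.
    apply/polyfunZ/polyfunD; [exact: polyfun_coord | exact: polyfun_cst].
  apply: polyfunZ; apply: polyfun_sum => j.
  rewrite mulSn addnC; apply: polyfunM (xP j).
  apply: (eq_polyfun _ (gP (upd z0 i0 (circle_pt w (c 0 i0) rho j)))) => z.
  congr g; apply/rowP => i; rewrite !mxE; case: ltngtP => [ik|ik|ik].
  - by rewrite ltnS (ltnW ik); case: eqP => // ii; rewrite ii ltnn in ik.
  - by rewrite ltnS leqNgt ik /=; case: eqP => // ii; rewrite ii ltnn in ik.
  - by have -> : i = i0 by [apply: val_inj]; rewrite eqxx.
have zk : `|z 0 i0 - c 0 i0 : C| <= r by have := zP i0; rewrite ltnSn.
have zr2 : polydisc c r2 z.
  move=> i; apply: le_trans (zP i) _; case: ifP => // _.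
  by rewrite /r2 mulr_natl mulr2n lerDl ltW.
have -> : h z - T i0 g z = (h z - T i0 h z) + (T i0 h z - T i0 g z).
  by rewrite addrA subrK.
apply: le_trans (ler_normD _ _) _.
apply: le_trans (lerD (Th _ _ zr2 zk) (TB _ _ _ _ ((2 ^+ k - 1) * e1) zk _)) _.
  move=> x xr; apply: gh => i; rewrite mxE.
  have [->|ii] := eqVneq i i0; first by rewrite ltnn.
  apply: le_trans (zP i) _; rewrite ltnS leq_eqVlt.
  have -> : (i == k :> nat) = false by apply/negP => /eqP ik; case/eqP: ii; apply: val_inj.
  by [].
by rewrite exprS le_eqVlt; apply/orP; left; apply/eqP; ring.
Qed.

End PolydiscApproximation.

(** * Polynomials do not vanish on small balls around near maxima *)

Section HermitianNorm.
Variables (R : realType) (n : nat).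
Local Notation C := (Rcomplex R).
Local Notation V := (Cvec R n).
Implicit Types (z : V).

(** The vector space structure on [Cvec] is over the reals; this is the
    multiplication by complex scalars. *)
Definition cdilate (t : C) z : V := \row_k (t * z 0 k).

Lemma cvec_normE z : `|z| = Num.sqrt (\sum_j `|z 0 j| ^+ 2).
Proof. by []. Qed.

Lemma norm_cdilate t z : `|cdilate t z| = `|t| * `|z|.
Proof.
rewrite !cvec_normE; under eq_bigr do rewrite mxE cnormM exprMn.
by rewrite -mulr_sumr sqrtrM ?sqr_ge0 // sqrtr_sqr normr_id.
Qed.

Lemma norm_coord_le z i : `|z 0 i| <= `|z|.
Proof.
rewrite cvec_normE -[leLHS]normr_id -sqrtr_sqr; apply: ler_wsqrtr.
by rewrite (bigD1 i) //= lerDl sumr_ge0 // => j _; exact: sqr_ge0.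
Qed.

Lemma norm_le_sum_coord z : `|z| <= \sum_i `|z 0 i|.
Proof.
rewrite cvec_normE -(@ler_pXn2r _ 2) ?nnegrE ?sqrtr_ge0 ?sumr_ge0 //.
rewrite sqr_sqrtr ?sumr_ge0 //.
rewrite [leRHS]expr2 mulr_suml; apply: ler_sum => i _.
rewrite expr2; apply: ler_wpM2l => //.
by rewrite (bigD1 i) //= lerDl sumr_ge0.
Qed.

Lemma cdilate_real (s : R) z : cdilate s%:A z = s *: z.
Proof. by apply/rowP => i; rewrite !mxE -scalerAl mul1r. Qed.

End HermitianNorm.

Section OneVariablePolynomials.
Variable R : realType.
Local Notation C := (Rcomplex R).

Lemma poly_nonroot_near0 (q : {poly C}) (e : R) : q != 0 -> 0 < e ->
  exists2 t : C, `|t| <= e & q.[t] != 0.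
Proof.
move=> q0 e0; apply: contrapT => H.
pose rs := [seq (e / k.+1%:R)%:A : C | k <- iota 0 (size q)].
have rsq : all (root q) rs.
  apply/allP => _ /mapP[k _ ->]; apply: contrapT => kr; apply: H.
  exists (e / k.+1%:R)%:A; last exact/negP.
  rewrite normrZ cnorm1 mulr1 ger0_norm; last by rewrite divr_ge0 // ltW.
  by rewrite ler_pdivrMr // ler_peMr ?ler1n // ltW.
have urs : uniq rs.
  rewrite map_inj_uniq ?iota_uniq // => i j /(congr1 (@complex.Re R)) /=.
  rewrite !mulr1 => /(mulfI (lt0r_neq0 e0)) /invr_inj /eqP.
  by rewrite eqr_nat => /eqP [].
by have := max_poly_roots q0 rsq urs; rewrite size_map size_iota ltnn.
Qed.

(** A coefficient is an average of the values at N-th roots of unity, times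
    unimodular factors, once N exceeds the degree. *)
Lemma coef_le_sup_circle (q : {poly C}) (B : R) k :
  (forall t : C, `|t| = 1 -> `|q.[t] : C| <= B) -> `|q`_k : C| <= B.
Proof.
move=> qB.
have B0 : 0 <= B by apply: le_trans (qB 1 (cnorm1 R)).
have [kq|qk] := ltnP k (size q); last by rewrite nth_default // normr0.
have [N [w qN [wN _]]] := primitive_root_near1 (size q) (ltr01 : 0 < 1 :> R).
have N0 : (0 < N)%N by apply: leq_ltn_trans qN.
have wNE := prim_expr_order wN; have w1 := cnorm_unity_root N0 wNE.
have kN : (k < N)%N by apply: ltn_trans qN.
have E : \sum_(j < N) q.[w ^+ j] * (w ^+ j) ^+ (N - k) = N%:R * q`_k.
  under eq_bigr do rewrite horner_coef mulr_suml.
  rewrite exchange_big (bigD1 (Ordinal kq)) //= [X in _ + X]big1 ?addr0.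
    rewrite (eq_bigr (fun=> q`_k)) => [|j _].
      by rewrite sumr_const card_ord mulr_natl.
    rewrite -mulrA -exprD subnKC ?(ltnW kN) // -exprM mulnC exprM wNE expr1n.
    by rewrite mulr1.
  move=> l lk.
  rewrite (eq_bigr (fun j : 'I_N => q`_l * (w ^+ (l + (N - k))) ^+ j)); last first.
    by move=> j _; rewrite -mulrA -exprD -!exprM mulnC.
  rewrite -mulr_sumr; suff -> : \sum_(j < N) (w ^+ (l + (N - k))) ^+ j = 0 by rewrite mulr0.
  have wlk : w ^+ (l + (N - k)) - 1 != 0.
    rewrite subr_eq0; apply/eqP => /(congr1 (fun x => x * w ^+ k)).
    rewrite -exprD -addnA subnK ?(ltnW kN) // exprD wNE mulr1 mul1r => /eqP.
    rewrite (eq_prim_root_expr wN) !modn_small //; last exact: ltn_trans qN.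
    by move=> lk'; case/eqP: lk; apply: val_inj; apply/eqP.
  apply: (mulfI wlk); rewrite mulr0 -subrX1 -exprM mulnC exprM wNE.
  by rewrite expr1n subrr.
have NR0 : 0 < N%:R :> R by rewrite ltr0n.
rewrite -(ler_pM2l NR0) -[N%:R in leLHS](cnorm_nat R) -cnormM -E.
apply: le_trans (ler_norm_sum _ _ _) _.
rewrite -[N in N%:R]card_ord [leRHS]mulr_natl -sumr_const; apply: ler_sum => j _.
rewrite cnormM !cnormX w1 !expr1n mulr1; apply: qB.
by rewrite cnormX w1 expr1n.
Qed.

End OneVariablePolynomials.

Section LineRestriction.
Variables (R : realType) (m : nat).
Local Notation C := (Rcomplex R).
Local Notation V := (Cvec R m).

Lemma polyfun_line (e : nat) (P : V -> C) (a b : V) : polyfun e P ->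
  exists2 q : {poly C}, (size q <= (m * e).+1)%N &
    forall t, P (a + cdilate t b) = q.[t].
Proof.
move=> [k kE].
exists (\sum_al k al *: \prod_i ((a 0 i)%:P + b 0 i *: 'X) ^+ al i).
  apply: leq_trans (size_sum _ _ _) _; apply/bigmax_leqP => al _.
  apply: leq_trans (size_scale_leq _ _) _.
  apply: leq_trans (size_prod_leq _ _) _.
  have lin (i : 'I_m) : (size ((a 0 i)%:P + b 0 i *: 'X : {poly C})%R <= 2)%N.
    apply: leq_trans (size_polyD _ _) _; rewrite geq_max.
    rewrite (leq_trans (size_polyC_leq1 _)) //=.
    by rewrite (leq_trans (size_scale_leq _ _)) // size_polyX.
  rewrite leq_subLR addnS ltnS.
  apply: (@leq_trans (\sum_(i < m) e.+1)).
    apply: leq_sum => i _; apply: leq_trans (size_poly_exp_leq _ _) _.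
    rewrite ltnS; apply: (@leq_trans (1 * al i)); last by rewrite mul1n -ltnS.
    by rewrite leq_mul2r; apply/orP; right; rewrite -subn1 leq_subLR.
  by rewrite sum_nat_const !card_ord mulnS.
move=> t; rewrite kE horner_sum; apply: eq_bigr => al _.
rewrite hornerZ horner_prod; congr (_ * _); apply: eq_bigr => i _.
by rewrite horner_exp !hornerE !mxE mulrC.
Qed.

(** A polynomial is large somewhere in the ball, grows slowly outside it, and
    so varies slowly around a point where it is nearly maximal. *)
Lemma polyfun_nonvanishing (e : nat) (P : V -> C) (w1 : V) (delta : R) :
  let D := (m * e)%N in
  (0 < D)%N -> polyfun e P -> P w1 != 0 -> 0 < delta <= 1 ->
  exists2 w0 : V, `|w0| <= delta & forall w : V,
    `|w - w0| < delta / (8 * D%:R ^+ 2 * D.+1%:R) -> P w != 0.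
Proof.
move=> D D0 Pe Pw1 /andP[d0 d1].
have P_bounded : exists B, forall w, `|w| <= delta -> `|P w| <= B.
  have [k kE] := Pe; exists (\sum_al `|k al|) => w wd.
  rewrite kE; apply: le_trans (ler_norm_sum _ _ _) _; apply: ler_sum => al _.
  rewrite cnormM ler_piMr // cnorm_prod; apply: prodr_ile1 => i _.
  rewrite normr_ge0 cnormX exprn_ile1 //.
  by apply: le_trans (norm_coord_le _ _) _; apply: le_trans wd _.
have [q0 _ q0E] := polyfun_line 0 w1 Pe.
have [t0 t0s qt0] : exists2 t : C, `|t| <= delta / (`|w1| + 1) & q0.[t] != 0.
  apply: poly_nonroot_near0; last by rewrite divr_gt0 // ltr_wpDl.
  apply/eqP => q00; have := q0E 1; rewrite q00 horner0 => /eqP.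
  have -> : 0 + cdilate 1 w1 = w1 by apply/rowP => i; rewrite !mxE add0r mul1r.
  by rewrite (negPf Pw1).
pose A := [set `|P w| | w in [set w | `|w| <= delta]].
pose S := sup A.
have At0 : A `|P (cdilate t0 w1)|.
  exists (cdilate t0 w1) => //=; rewrite norm_cdilate.
  apply: le_trans (ler_wpM2r (normr_ge0 _) t0s) _.
  rewrite mulrAC ler_pdivrMr ?ltr_wpDl // ler_pM2l // lerDl //.
have Asup : has_sup A.
  split; first by exists `|P (cdilate t0 w1)|.
  by have [B PB] := P_bounded; exists B => _ [w wd <-]; exact: PB.
have PS w : `|w| <= delta -> `|P w| <= S.
  by move=> wd; apply: ub_le_sup; [case: Asup | exists w].
have S0 : 0 < S.
  apply: lt_le_trans (ub_le_sup (proj2 Asup) At0); rewrite normr_gt0.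
  by rewrite -[cdilate _ _]add0r q0E.
have [_ [w0 w0d <-] Pw0] : exists2 x, A x & S / 2 < x.
  have := sup_adherent (divr_gt0 S0 (ltr0n _ 2)) Asup.
  by move=> [x Ax xS]; exists x => //; move: xS; rewrite -/S; lra.
have DR0 : 1 <= D%:R :> R by rewrite ler1n.
have DR1 : 0 < D%:R :> R by rewrite ltr0n.
(* The ball is enlarged by the factor 1 / mu, and mu ^ D >= 1 / 2 keeps the
   growth of polynomials of degree D under control. *)
pose mu : R := 1 - (2 * D%:R)^-1.
have x12 : (2 * D%:R)^-1 <= 2^-1 :> R by rewrite lef_pV2 ?posrE ?mulr_gt0 // ler_peMr.
have x0 : 0 < (2 * D%:R)^-1 :> R by rewrite invr_gt0 mulr_gt0.
have mu0 : 0 < mu by rewrite /mu; lra.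
have mu1 : mu <= 1 by rewrite /mu; lra.
have muD : 2^-1 <= mu ^+ D.
  have ber j : 1 - j%:R * (2 * D%:R)^-1 <= mu ^+ j.
    elim: j => [|j IH]; first by rewrite mul0r subr0.
    rewrite exprS; apply: le_trans (ler_wpM2l (ltW mu0) IH).
    rewrite -natr1 /mu; have : 0 <= j%:R :> R by []. nra.
  apply: le_trans (ber D); rewrite invfM mulrCA mulfV ?gt_eqF //; lra.
have growth w : `|w| <= delta / mu -> `|P w| <= 2 * D.+1%:R * S.
  move=> wd; have [q qs qE] := polyfun_line 0 (mu *: w) Pe.
  have qS k : `|q`_k : C| <= S.
    apply: coef_le_sup_circle => t t1; rewrite -qE; apply: PS.
    rewrite add0r norm_cdilate t1 mul1r normrZ ger0_norm ?(ltW mu0) //.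
    by rewrite mulrC -ler_pdivlMr.
  have -> : P w = q.[(mu^-1)%:A].
    by rewrite -qE add0r cdilate_real scalerA mulVf ?gt_eqF // scale1r.
  rewrite (horner_coef_wide _ qs); apply: le_trans (ler_norm_sum _ _ _) _.
  have -> : 2 * D.+1%:R * S = (S * 2) *+ D.+1 by rewrite -[RHS]mulr_natr; ring.
  rewrite -[D.+1 in leRHS]card_ord -sumr_const; apply: ler_sum => j _.
  rewrite cnormM ler_pM //.
  rewrite cnormX normrZ cnorm1 mulr1 ger0_norm ?invr_ge0 ?(ltW mu0) //.
  have muj : 2^-1 <= mu ^+ j.
    apply: le_trans muD _; rewrite ler_wiXn2l ?(ltW mu0) //.
    by rewrite -ltnS.
  by rewrite exprVn -[leRHS]invrK lef_pV2 ?posrE ?exprn_gt0 ?invr_gt0.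
exists w0 => // w wd; apply/negP => /eqP Pw.
have [ww0|ww0] := eqVneq w w0.
  by move: Pw0; rewrite -ww0 Pw normr0; lra.
pose s := `|w - w0|; have s0 : 0 < s by rewrite normr_gt0 subr_eq0.
pose u : V := (delta / (2 * D%:R) / s) *: (w - w0).
have un : `|u| = delta / (2 * D%:R).
  rewrite normrZ ger0_norm; last by rewrite !(divr_ge0, mulr_ge0) // ltW.
  by rewrite divfK // gt_eqF.
have [q qs qE] := polyfun_line w0 u Pe.
have qB k : `|q`_k : C| <= 2 * D.+1%:R * S.
  apply: coef_le_sup_circle => t t1; rewrite -qE; apply: growth.
  apply: le_trans (ler_normD _ _) _; rewrite norm_cdilate t1 mul1r un.
  rewrite ler_pdivlMr //.
  apply: (@le_trans _ _ ((delta + delta * (2 * D%:R)^-1) * mu)).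
    by rewrite ler_wpM2r ?(ltW mu0) // lerD2r.
  rewrite /mu; move: x0; set x := _^-1; nra.
pose t1 : R := s * (2 * D%:R) / delta.
have t10 : 0 <= t1 by rewrite !(divr_ge0, mulr_ge0) // ltW.
have wE : w = w0 + cdilate t1%:A u.
  rewrite cdilate_real /u scalerA.
  have -> : t1 * (delta / (2 * D%:R) / s) = 1.
    by rewrite /t1; field; rewrite !gt_eqF.
  by rewrite scale1r addrC subrK.
have t1lt : t1 < (4 * D%:R * D.+1%:R)^-1.
  rewrite /t1 ltr_pdivrMr // -ltr_pdivlMr ?mulr_gt0 //.
  apply: lt_le_trans wd _; rewrite le_eqVlt; apply/orP; left; apply/eqP.
  have DS0 : 0 < D.+1%:R :> R by [].
  by move: (D.+1%:R : R) DS0 => D' D'0; field; rewrite !gt_eqF.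
have t1le1 : t1 <= 1.
  apply: le_trans (ltW t1lt) _; rewrite invf_le1 ?mulr_gt0 //.
  have : 1 <= D.+1%:R :> R by rewrite ler1n.
  move: (D.+1%:R : R) (D%:R : R) DR0 => x y; nra.
have : `|P w0| <= D%:R * (2 * D.+1%:R * S) * t1.
  have -> : P w0 = q.[0].
    rewrite -qE; congr P; apply/rowP => i; rewrite !mxE mul0r addr0 //.
  pose t1C : C := t1%:A; have qt1 := qE t1C; rewrite -wE Pw in qt1.
  have -> : q.[0] = q.[0] - q.[t1C] by rewrite -qt1 subr0.
  rewrite !(horner_coef_wide _ qs) -sumrB big_ord_recl !expr0 subrr add0r.
  apply: le_trans (ler_norm_sum _ _ _) _.
  rewrite -mulrA [leRHS]mulr_natl -[D in leRHS]card_ord -sumr_const.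
  apply: ler_sum => j _; rewrite /= /bump /= add1n expr0n /= mulr0 sub0r normrN.
  rewrite cnormM; apply: ler_pM => //; first by rewrite card_ord; exact: qB.
  rewrite cnormX /t1C normrZ cnorm1 mulr1 ger0_norm //.
  by rewrite exprS ler_piMr // exprn_ile1.
apply/negP; rewrite -ltNge; apply: lt_trans Pw0.
have DS0 : 0 < D.+1%:R :> R by [].
apply: (@lt_le_trans _ _ (D%:R * (2 * D.+1%:R * S) * (4 * D%:R * D.+1%:R)^-1)).
  by rewrite ltr_pM2l // !mulr_gt0.
rewrite le_eqVlt; apply/orP; left; apply/eqP.
by move: (D.+1%:R : R) DS0 => D' D'0; field; rewrite !gt_eqF.
Qed.

End LineRestriction.

(** * Algebraic relations between polynomials *)

Lemma sum_digits (D m b : nat) :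
  (\sum_(i < m) (b %/ D ^ i %% D) * D ^ i = b %% D ^ m)%N.
Proof.
elim: m => [|m IH]; first by rewrite big_ord0 expn0 modn1.
rewrite big_ord_recr /= IH modn_divl -expnS.
have -> : (b %% D ^ m = b %% D ^ m.+1 %% D ^ m)%N.
  by rewrite modn_dvdm // dvdn_exp2l.
by rewrite addnC -divn_eq.
Qed.

Section AlgebraicRelation.
Variable R : realType.
Local Notation C := (Rcomplex R).

(** A linear relation between the D ^ m monomials of degree < D in the
    polynomials G k: they live in a space of dimension (e + 1) ^ n.  It does
    not vanish identically, as the substitution w_k = t ^ (D ^ k) turns
    distinct monomials into distinct powers of t. *)
Lemma algebraic_relation (n m d D : nat) (G : 'I_m -> Cvec R n -> C) :
  (forall k, polyfun d (G k)) -> ((m * (D * d)).+1 ^ n < D ^ m)%N ->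
  exists P : Cvec R m -> C, [/\ polyfun D P, exists w, P w != 0 &
    forall z, P (\row_k G k z) = 0].
Proof.
move=> Gd dim.
have D0 : (0 < D)%N.
  case: D m dim G Gd => // -[|m] dim G Gd; last by rewrite exp0n in dim.
  by rewrite mul0n exp1n in dim.
pose dig (b k : nat) := (b %/ D ^ k %% D)%N.
have digD b k : (dig b k < D)%N by rewrite ltn_mod.
set e := (m * (D * d))%N in dim.
pose I := {ffun 'I_n -> 'I_e.+1}.
have GP (b : 'I_(D ^ m)) : polyfun e (fun z => \prod_(k < m) G k z ^+ dig b k).
  apply: (@polyfunW _ _ (\sum_(k < m) dig b k * d)).
    apply: (@leq_trans (\sum_(k < m) D * d)); last by rewrite sum_nat_const card_ord.
    by apply: leq_sum => k _; rewrite leq_mul2r (ltnW (digD _ _)) orbT.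
  by apply: polyfun_prod => k; apply: polyfunX.
have [c cE] := choice GP.
pose M : 'M[C]_(D ^ m, #|I|) := \matrix_(b, j) c b (enum_val j).
have rk : kermx M != 0.
  rewrite -mxrank_eq0 mxrank_ker -lt0n subn_gt0.
  by apply: leq_ltn_trans (rank_leq_col _) _; rewrite card_ffun !card_ord.
have /rowV0Pn[v /submxP[u vE] v0] := rk.
have vM : v *m M = 0 by rewrite vE -mulmxA mulmx_ker mulmx0.
(* The exponents of w in the b-th monomial are the digits of b in base D. *)
pose P (w : Cvec R m) : C := \sum_b v 0 b * \prod_(k < m) w 0 k ^+ dig b k.
exists P; split.
- apply: polyfun_sum => b; apply: polyfunZ.
  by apply: polyfun_monomial => k; apply: ltnW.
- pose q : {poly C} := \poly_(b < D ^ m) (if insub b is Some i then v 0 i else 0).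
  have q0 : q != 0.
    apply: contra v0 => /eqP q0; apply/eqP/rowP => b; rewrite mxE.
    have : q`_b = 0 by rewrite q0 coef0.
    by rewrite coef_poly ltn_ord valK.
  have [t _ qt] := poly_nonroot_near0 q0 (ltr01 : 0 < 1 :> R).
  exists (\row_k t ^+ (D ^ k)); suff -> : P (\row_k t ^+ (D ^ k)) = q.[t] by [].
  rewrite /P horner_poly; apply: eq_bigr => b _; rewrite valK; congr (_ * _).
  under eq_bigr do rewrite mxE -exprM mulnC.
  by rewrite -expr_sum sum_digits modn_small.
move=> z; rewrite /P.
under eq_bigr => b _.
  under eq_bigr do rewrite mxE.
  rewrite cE; over.
rewrite (eq_bigr (fun b => \sum_al v 0 b * c b al * monomial (fun i => al i) z)); last first.
  by move=> b _; rewrite mulr_sumr; apply: eq_bigr => al _; rewrite mulrA.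
rewrite exchange_big big1 // => al _; rewrite -mulr_suml.
have := congr1 (fun A : 'rV_#|I| => A 0 (enum_rank al)) vM; rewrite !mxE => h.
rewrite (eq_bigr (fun b => v 0 b * M b (enum_rank al))) ?h ?mul0r // => b _.
by rewrite mxE enum_rankK.
Qed.
End AlgebraicRelation.

(** * Mean value inequalities *)

Section BoundedLinearMaps.
Variables (R : realType) (V W W' : normedModType R).

Lemma bounded_linear_cts (l : W -> W') (k : R) :
  linear l -> (forall x, `|l x| <= k * `|x|) -> continuous l.
Proof.
move=> ll lk; pose lm := GRing.isLinear.Build _ _ _ _ _ ll.
pose lL : {linear W -> W'} := HB.pack l lm.
apply: (@bounded_linear_continuous _ _ _ lL).
apply/linear_boundedP; exists `|k|; split; first exact: num_real.
move=> x kx y; apply: le_trans (lk y) _; apply: ler_wpM2r => //.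
by apply: le_trans (ler_norm _) _; exact: ltW.
Qed.

Lemma bounded_linear_differentiable (l : W -> W') (k : R) x :
  linear l -> (forall x, `|l x| <= k * `|x|) -> differentiable l x.
Proof.
move=> ll lk; pose lm := GRing.isLinear.Build _ _ _ _ _ ll.
pose lL : {linear W -> W'} := HB.pack l lm.
exact: (@linear_differentiable _ _ _ lL x (bounded_linear_cts ll lk)).
Qed.

Lemma is_derive_bounded_linear (l : W -> W') (k : R) (F : V -> W) x u :
  linear l -> (forall x, `|l x| <= k * `|x|) -> derivable F x u ->
  is_derive x u (l \o F) (l ('D_u F x)).
Proof.
move=> ll lk dF; have lc := bounded_linear_cts ll lk.
pose lm := GRing.isLinear.Build _ _ _ _ _ ll.
pose lL : {linear W -> W'} := HB.pack l lm.
have H : (fun h : R => h^-1 *: (((l \o F) \o shift x) (h *: u) - (l \o F) x)) @ 0^'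
    --> l ('D_u F x).
  have -> : (fun h : R => h^-1 *: (((l \o F) \o shift x) (h *: u) - (l \o F) x)) =
     l \o (fun h : R => h^-1 *: ((F \o shift x) (h *: u) - F x)).
    by apply/funext => h /=; rewrite -[l]/(lL : W -> W') -linearB -linearZ.
  by apply: continuous_cvg; [exact: lc | exact: dF].
by split; [apply: cvgP H | apply: cvg_lim H].
Qed.

Lemma is_derive_line (F : V -> W) (z u : V) (c : R) dF :
  is_derive (z + c *: u) u F dF -> is_derive c 1 (fun c => F (z + c *: u)) dF.
Proof.
have E : (fun h : R => h^-1 *: (((fun c : R => F (z + c *: u)) \o shift c) (h *: (1:R))
      - F (z + c *: u))) =
   (fun h : R => h^-1 *: ((F \o shift (z + c *: u)) (h *: u) - F (z + c *: u))).
  apply/funext => h /=; congr (_ *: (F _ - _)).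
  by rewrite [_%:A]mulr1 scalerDl addrCA.
by case=> d dE; split; [rewrite /derivable E | rewrite /derive E].
Qed.

End BoundedLinearMaps.

Section MeanValue.
Variable R : realType.
Local Notation C := (Rcomplex R).
Variable V : normedModType R.

Lemma Re_linear : linear (@complex.Re R : C -> R).
Proof. by move=> a [x y] [x' y']. Qed.

Lemma Im_linear : linear (@complex.Im R : C -> R).
Proof. by move=> a [x y] [x' y']. Qed.

(** The mean value theorem holds for real functions, so it is applied to the
    real and imaginary parts separately, which costs the factor 2. *)
Lemma mean_value_line (F : V -> C) (z u : V) (L : C) (B : R) :
  (forall c, 0 <= c <= 1 -> derivable F (z + c *: u) u) ->
  (forall c, 0 <= c <= 1 -> `|'D_u F (z + c *: u) - L| <= B) ->
  `|F (z + u) - F z - L| <= 2 * B.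
Proof.
move=> dF FB.
have part (l : C -> R) : linear l -> (forall x, `|l x| <= `|x|) ->
    `|l (F (z + u) - F z - L)| <= B.
  move=> ll lB; have lB1 x : `|l x| <= 1 * `|x| by rewrite mul1r.
  pose lm := GRing.isLinear.Build _ _ _ _ _ ll.
  pose lL : {linear C -> R} := HB.pack l lm.
  have lBB x y : l (x - y) = l x - l y by rewrite -[l]/(lL : C -> R) linearB.
  have dg (c : R) : 0 <= c <= 1 ->
      is_derive c 1 (fun c => l (F (z + c *: u))) (l ('D_u F (z + c *: u))).
    move=> c01; apply: (@is_derive_line R V R (l \o F)).
    exact: (is_derive_bounded_linear ll lB1 (dF c c01)).
  have [c c01 E] : exists2 c : R, c \in `]0, 1[ & l (F (z + 1 *: u)) - l (F (z + 0 *: u))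
       = l ('D_u F (z + c *: u)) * (1 - 0).
    apply: (@MVT R (fun c => l (F (z + c *: u))) (fun c => l ('D_u F (z + c *: u)))).
    - exact: ltr01.
    - by move=> c; rewrite in_itv /= => /andP[c0 c1]; apply: dg; rewrite !ltW.
    - apply: derivable_within_continuous => c; rewrite in_itv /= => c01.
      by have := dg c c01; case.
  rewrite scale1r scale0r addr0 subr0 mulr1 in E.
  rewrite !lBB E -lBB; apply: le_trans (lB _) _; apply: FB.
  by move: c01; rewrite in_itv /= => /andP[c0 c1]; rewrite !ltW.
apply: le_trans (cnorm_le_ReIm _) _; rewrite mulr_natl mulr2n lerD //.
  exact: (part _ Re_linear (@norm_Re_le R)).
exact: (part _ Im_linear (@norm_Im_le R)).
Qed.

Lemma lipschitz_line (F : V -> C) (z u : V) (B : R) :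
  (forall c, 0 <= c <= 1 -> derivable F (z + c *: u) u) ->
  (forall c, 0 <= c <= 1 -> `|'D_u F (z + c *: u)| <= B) ->
  `|F (z + u) - F z| <= 2 * B.
Proof.
move=> dF FB; have := mean_value_line (L := 0) dF.
by rewrite subr0; apply => c c01; rewrite subr0; exact: FB.
Qed.

End MeanValue.

(** * Derivatives of smooth functions with small dbar *)

Section ClosedBallCompact.
Variables (R : realType) (n : nat).
Local Notation C := (Rcomplex R).
Local Notation V := (Cvec R n).

(** Transfers the compactness of closed bounded sets of real row vectors, for
    the sup norm, to the Hermitian norm. *)
Let pack_re_im (x : 'rV[R]_(n + n)) : V :=
  \row_i (Complex (x 0 (lshift n i)) (x 0 (rshift n i)) : C).

Let pack_continuous : continuous pack_re_im.
Proof.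
apply: (@bounded_linear_cts R _ _ pack_re_im (2 * n%:R)).
  by move=> a x y; apply/rowP => i; rewrite !mxE.
move=> x; apply: le_trans (norm_le_sum_coord _) _.
have xi k : `|x 0 k| <= `|x|.
  by rewrite [leRHS]/Num.Def.normr /= mx_normrE; apply: (le_bigmax _ (fun ij => `|x ij.1 ij.2|) (0, k)).
apply: (@le_trans _ _ (\sum_(i < n) (`|x| *+ 2))).
  apply: ler_sum => i _; apply: le_trans (cnorm_le_ReIm _) _.
  by rewrite !mxE /= mulr2n lerD.
by rewrite sumr_const card_ord -mulrnA -[leLHS]mulr_natl natrM.
Qed.

Lemma closed_ball_compact (rho : R) : compact [set z : V | `|z| <= rho].
Proof.
pose S := [set x : 'rV[R]_(n + n) | `|pack_re_im x| <= rho].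
have -> : [set z : V | `|z| <= rho] = pack_re_im @` S.
  apply/seteqP; split => [z zr|_ [x xS <-]] //.
  pose x : 'rV[R]_(n + n) :=
    row_mx (\row_i complex.Re (z 0 i)) (\row_i complex.Im (z 0 i)).
  have xz : pack_re_im x = z.
    by apply/rowP => i; rewrite mxE /x row_mxEl row_mxEr !mxE; case: (z 0 i).
  by exists x => //; rewrite /S /= xz.
apply: continuous_compact; first exact/continuous_subspaceT/pack_continuous.
apply: bounded_closed_compact.
  exists rho; split; first exact: num_real.
  move=> M rM x xS /=; rewrite [leLHS]/Num.Def.normr /= mx_normrE.
  apply: bigmax_le => [|[i k] _].
    by apply: le_trans (normr_ge0 _) (le_trans xS (ltW rM)).
  rewrite ord1 /=; apply: le_trans (ltW rM); apply: le_trans xS.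
  case: (split_ordP k) => j ->; apply: le_trans (norm_coord_le _ j); rewrite mxE.
    exact: (@norm_Re_le R (Complex _ _)).
  exact: (@norm_Im_le R (Complex _ _)).
apply: (@preimage_closed _ _ (fun x => `|pack_re_im x|) [set r | r <= rho]).
  move=> x _; apply: continuous_comp; [exact: pack_continuous | exact: norm_continuous].
exact: closed_le.
Qed.

Lemma bounded_on_closed_ball (W : normedModType R) (F : V -> W) (rho : R) :
  (forall z, `|z| <= rho -> {for z, continuous F}) ->
  exists K : R, forall z, `|z| <= rho -> `|F z| <= K.
Proof.
move=> Fc.
have : compact (F @` [set z : V | `|z| <= rho]).
  apply: continuous_compact (@closed_ball_compact rho).
  by apply: continuous_in_subspaceT => z; rewrite inE; exact: Fc.
move=> /compact_bounded [K [_ KF]]; exists (K + 1) => z zr.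
by apply: (KF (K + 1)); [rewrite ltrDl | exists z].
Qed.

End ClosedBallCompact.

Section ComplexCoordinates.
Variables (R : realType) (n : nat).
Local Notation C := (Rcomplex R).
Local Notation V := (Cvec R n).

Definition axis (i : 'I_n) (x : C) : V := \row_k (if k == i then x else 0).

Lemma axisE i x :
  axis i x = complex.Re x *: basis_x R i + complex.Im x *: basis_y R i.
Proof.
apply/rowP => k; rewrite !mxE; case: eqP => _; last by rewrite mul0r !scaler0 addr0.
case: x => x y /=; apply/eqP; rewrite eq_complex /=.
by apply/andP; split; apply/eqP; ring.
Qed.

Lemma basis_xE i : basis_x R i = axis i 1.
Proof. by apply/rowP => k; rewrite !mxE; case: eqP. Qed.

Lemma norm_axis i x : `|axis i x| = `|x|.
Proof.
rewrite cvec_normE (bigD1 i) //= big1 => [|k ki].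
  by rewrite mxE eqxx addr0 sqrtr_sqr normr_id.
by rewrite mxE (negPf ki) normr0 expr0n.
Qed.

Lemma axis_linear i : linear (axis i).
Proof.
move=> a x y; apply/rowP => k; rewrite !mxE; case: eqP => _ //.
by rewrite scaler0 addr0.
Qed.

Lemma axisZ i (s : R) x : axis i (s *: x) = s *: axis i x.
Proof. by apply/rowP => k; rewrite !mxE; case: eqP; rewrite // scaler0. Qed.

Variable f : V -> C.

(** Wirtinger derivatives. *)
Definition dz (i : 'I_n) (z : V) : C :=
  2^-1 * ('D_(basis_x R i) f z - ('i%C : C) * 'D_(basis_y R i) f z).
Definition dzbar (i : 'I_n) (z : V) : C := dbar f z 0 i.

Lemma wirtinger (x p q : C) : complex.Re x *: p + complex.Im x *: q =
  2^-1 * (p - ('i%C : C) * q) * x + 2^-1 * (p + ('i%C : C) * q) * (x^*)%C.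
Proof.
have xE : x = (complex.Re x)%:A + ('i%C : C) * (complex.Im x)%:A.
  case: x => x y; apply/eqP; rewrite eq_complex /=.
  by apply/andP; split; apply/eqP; ring.
have xcE : (x^*)%C = (complex.Re x)%:A - ('i%C : C) * (complex.Im x)%:A :> C.
  case: x {xE} => x y; apply/eqP; rewrite eq_complex /=.
  by apply/andP; split; apply/eqP; ring.
have i2 : ('i%C : C) * 'i%C = -1 by rewrite -expr2; exact: sqr_i.
have sc (s : R) (y : C) : s *: y = s%:A * y by rewrite -scalerAl mul1r.
have two0 : (2%:R : C) != 0 by rewrite -normr_eq0 cnorm_nat pnatr_eq0.
rewrite (sc _ p) (sc _ q) xcE [in X in _ = X + _]xE.
move: ((complex.Re x)%:A : C) ((complex.Im x)%:A : C) => r s.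
move: ('i%C : C) i2 => I i2.
transitivity (r * p - (I * I) * (s * q)); first by rewrite i2 mulN1r opprK.
by field.
Qed.

Lemma derive_axis_real (F : V -> C) i z x : differentiable F z ->
  'D_(axis i x) F z =
    complex.Re x *: 'D_(basis_x R i) F z + complex.Im x *: 'D_(basis_y R i) F z.
Proof. by move=> dF; rewrite deriveE // axisE linearD !linearZ /= -!deriveE. Qed.

Lemma norm_comb_le (x p q : C) (K : R) : `|p| <= K -> `|q| <= K ->
  `|complex.Re x *: p + complex.Im x *: q| <= 2 * (K * `|x|).
Proof.
move=> pK qK; apply: le_trans (ler_normD _ _) _; rewrite !normrZ.
rewrite mulr_natl mulr2n [K * _]mulrC.
by apply: lerD; apply: ler_pM; rewrite ?norm_Re_le ?norm_Im_le.
Qed.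

Lemma derive_axis i z x : differentiable f z ->
  'D_(axis i x) f z = dz i z * x + dzbar i z * (x^*)%C.
Proof.
move=> df; rewrite deriveE // axisE linearD !linearZ /= -!deriveE //.
by rewrite wirtinger /dz /dzbar mxE.
Qed.

End ComplexCoordinates.

Section SmoothFunctionFacts.
Variables (R : realType) (n : nat).
Local Notation C := (Rcomplex R).
Local Notation V := (Cvec R n).
Variables (rho eta : R) (f : V -> C).
Local Notation Bp := (ball (0 : V) rho).
Hypothesis f_smooth : smooth_on Bp f.
Hypothesis f_C1 : (Cr_norm 1 Bp f <= 1%:E)%E.
Hypothesis dbar_C2 : (Cr_norm 2 Bp (dbar f) <= eta%:E)%E.

Lemma ball0E (z : V) r : ball (0 : V) r z = (`|z| < r) :> Prop.
Proof. by rewrite -ball_normE /ball_ /= sub0r normrN. Qed.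

Lemma Cr_norm_le (W : normedModType R) (r : nat) (A : set V) (F : V -> W) (b : R) s z :
  (Cr_norm r A F <= b%:E)%E -> (size s <= r)%N -> A z -> `|iter_partial F s z| <= b.
Proof.
move=> Fb sr Az; rewrite -lee_fin; apply: le_trans Fb.
by apply: ereal_sup_ubound; exists s, z.
Qed.

Lemma norm_le1_of_C1 z : `|z| < rho -> `|f z| <= 1.
Proof. by move=> zr; apply: (Cr_norm_le (s := [::]) f_C1); rewrite ?ball0E. Qed.

Lemma differentiable_of_smooth z : `|z| < rho -> differentiable f z.
Proof. by move=> zr; apply: (f_smooth [::]); rewrite ball0E. Qed.

Lemma dzbar_le i z : `|z| < rho -> `|dzbar f i z| <= eta.
Proof.
move=> zr; apply: le_trans (norm_coord_le _ _) _.
by apply: (Cr_norm_le (s := [::]) dbar_C2); rewrite ?ball0E.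
Qed.

Lemma derive_x_le i z : `|z| < rho -> `|'D_(basis_x R i) f z| <= 1.
Proof.
by move=> zr; apply: (Cr_norm_le (s := [:: inl i]) f_C1); rewrite ?ball0E.
Qed.

Let mulc_linear (c : C) : linear (fun x : C => c * x).
Proof. by move=> a x y; rewrite mulrDr cscalerAr. Qed.

Lemma differentiable_dzbar i z : `|z| < rho -> differentiable (dzbar f i) z.
Proof.
move=> zr; have Bz : Bp z by rewrite ball0E.
have cB (c x : C) : `|c * x : C| <= `|c| * `|x| by rewrite cnormM.
have -> : dzbar f i = (fun x : C => 2^-1 * x) \o
   ('D_(basis_x R i) f + ((fun x : C => ('i%C : C) * x) \o 'D_(basis_y R i) f)).
  by apply/funext => y; rewrite /dzbar mxE.
apply: differentiable_comp; last exact: bounded_linear_differentiable (mulc_linear _) (cB _).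
apply: differentiableD; first exact: (f_smooth [:: inl i] Bz).
apply: differentiable_comp; last exact: bounded_linear_differentiable (mulc_linear _) (cB _).
exact: (f_smooth [:: inr i] Bz).
Qed.

Lemma derivable_dbar z u : `|z| < rho -> derivable (dbar f) z u.
Proof.
move=> zr.
have -> : dbar f = \sum_i (axis i \o dzbar f i).
  apply/funext => y; apply/rowP => k; rewrite fct_sumE summxE (bigD1 k) //= big1.
    by rewrite addr0 [RHS]mxE eqxx.
  by move=> i ik; rewrite mxE eq_sym (negPf ik).
apply: derivable_sum => i.
have aB (x : C) : `|axis i x| <= 1 * `|x| by rewrite norm_axis mul1r.
have di : derivable (dzbar f i) z u := diff_derivable (differentiable_dzbar i zr).
by have [] := is_derive_bounded_linear (@axis_linear R n i) aB di.
Qed.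

Let coord_linear i : linear (fun z : V => z 0 i).
Proof. by move=> a x y; rewrite !mxE. Qed.

Lemma derive_dzbar_le i j z : `|z| < rho -> `|'D_(basis_x R j) (dzbar f i) z| <= eta.
Proof.
move=> zr.
have cB (x : V) : `|x 0 i| <= 1 * `|x| by rewrite mul1r norm_coord_le.
have [_ ->] := is_derive_bounded_linear (coord_linear i) cB (@derivable_dbar z (basis_x R j) zr).
apply: le_trans (norm_coord_le _ _) _.
by apply: (Cr_norm_le (s := [:: inl j]) dbar_C2); rewrite ?ball0E.
Qed.

Let segment z (u : V) (r c : R) : 0 <= c <= 1 -> `|z| <= r -> `|z + u| <= r ->
  `|z + c *: u| <= r.
Proof.
move=> /andP[c0 c1] zr ur.
have -> : z + c *: u = (1 - c) *: z + c *: (z + u).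
  by rewrite scalerBl scale1r scalerDr addrA subrK.
apply: le_trans (ler_normD _ _) _.
rewrite !normrZ (ger0_norm c0) ger0_norm ?subr_ge0 //.
have h1 : (1 - c) * `|z| <= (1 - c) * r by rewrite ler_wpM2l // subr_ge0.
have h2 : c * `|z + u| <= c * r by rewrite ler_wpM2l.
by apply: le_trans (lerD h1 h2) _; rewrite -mulrDl subrK mul1r.
Qed.

Let derive_scale (F : V -> C) z (u : V) (s : R) : differentiable F z ->
  'D_(s *: u) F z = s *: 'D_u F z.
Proof. by move=> dF; rewrite !deriveE // linearZ. Qed.

Variable r : R.
Hypothesis r_rho : r < rho.

Lemma dzbar_lipschitz_along_x i j z (t : R) : 0 <= t -> `|z| <= r -> `|z + axis j t%:A| <= r ->
  `|dzbar f i (z + axis j t%:A) - dzbar f i z| <= 2 * (t * eta).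
Proof.
move=> t0 zr; rewrite axisZ -basis_xE => ztr.
apply: lipschitz_line => c c01;
  have zc := le_lt_trans (segment c01 zr ztr) r_rho.
  exact/diff_derivable/differentiable_dzbar.
rewrite derive_scale; last exact: differentiable_dzbar.
by rewrite normrZ ger0_norm // ler_wpM2l // derive_dzbar_le.
Qed.

Lemma lipschitz_along_x j z (t : R) : 0 <= t -> `|z| <= r -> `|z + axis j t%:A| <= r ->
  `|f (z + axis j t%:A) - f z| <= 2 * t.
Proof.
move=> t0 zr; rewrite axisZ -basis_xE => ztr.
apply: lipschitz_line => c c01;
  have zc := le_lt_trans (segment c01 zr ztr) r_rho.
  exact/diff_derivable/differentiable_of_smooth.
rewrite derive_scale; last exact: differentiable_of_smooth.
by rewrite normrZ ger0_norm // ler_piMr // derive_x_le.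
Qed.

Lemma second_derivatives_bounded : exists2 K : R, 0 <= K &
  forall d e z, `|z| <= r -> `|iter_partial f [:: d; e] z| <= K.
Proof.
have H d e : exists K : R, forall z, `|z| <= r -> `|iter_partial f [:: d; e] z| <= K.
  apply: bounded_on_closed_ball => z zr; apply: differentiable_continuous.
  by apply: f_smooth; rewrite ball0E; apply: le_lt_trans r_rho.
have [K HK] := choice (fun de => H de.1 de.2).
exists (\sum_de `|K de|); first by rewrite sumr_ge0.
move=> d e z zr; apply: le_trans (HK (d, e) z zr) _.
by rewrite (bigD1 (d, e)) //= ler_wpDr ?sumr_ge0 // ler_norm.
Qed.

(** K comes from the compactness of the closed ball and depends on f: it may
    only be used where it gets multiplied by a step chosen after f. *)
Lemma taylor_along_axis : exists2 K : R, 0 <= K &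
  forall i z (x : C), `|z| <= r -> `|z + axis i x| <= r ->
  `|f (z + axis i x) - f z - (dz f i z * x + dzbar f i z * (x^*)%C) : C|
    <= K * `|x| ^+ 2.
Proof.
have [K K0 KB] := second_derivatives_bounded.
exists (16 * K); first by rewrite mulr_ge0.
move=> i z x zr zxr.
have zc (c : R) : 0 <= c <= 1 -> `|z + c *: axis i x| <= r by move=> c01; exact: segment.
have dd d w : `|w| <= r -> differentiable ('D_(real_basis R d) f) w.
  by move=> wr; apply: (f_smooth [:: d]); rewrite ball0E (le_lt_trans wr).
have part d c : 0 <= c <= 1 ->
    `|'D_(real_basis R d) f (z + c *: axis i x) - 'D_(real_basis R d) f z|
      <= 2 * (2 * (K * `|x|)).
  move=> c01; apply: (@lipschitz_line R V ('D_(real_basis R d) f) z (c *: axis i x)) => c' c01';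
    have zc' := segment c01' zr (zc c c01).
    exact/diff_derivable/dd.
  rewrite derive_scale; last exact: dd.
  rewrite normrZ; have /andP[c0 c1] := c01; rewrite ger0_norm //.
  apply: (@le_trans _ _ (1 * (2 * (K * `|x|)))); last by rewrite mul1r.
  apply: ler_pM => //; rewrite derive_axis_real; last exact: dd.
  apply: norm_comb_le; first exact: (KB (inl i) d).
  exact: (KB (inr i) d).
have fd w : `|w| <= r -> differentiable f w.
  by move=> wr; apply: differentiable_of_smooth; apply: le_lt_trans r_rho.
rewrite -derive_axis; last exact: fd.
have -> : 16 * K * `|x| ^+ 2 = 2 * (2 * (2 * (2 * (K * `|x|)) * `|x|)) by ring.
apply: mean_value_line => c c01; first exact/diff_derivable/fd/zc.
rewrite !derive_axis_real; [| exact: fd | exact/fd/zc].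
rewrite opprD addrACA -!scalerBr; apply: norm_comb_le.
  exact: (part (inl i)).
exact: (part (inr i)).
Qed.

End SmoothFunctionFacts.

(** * Transversality from a large holomorphic derivative *)

Section RightInverse.
Variable R : realType.
Local Notation C := (Rcomplex R).

Lemma cnormJ (x : C) : `|(x^*)%C : C| = `|x|.
Proof.
by case: x => a b; rewrite /Num.norm /= sqrrN.
Qed.

Variable V : normedModType R.

(** Restricted to the complex line inj, L is x |-> a x + b conj x, with inverse
    s |-> (conj a s - b conj s) / (|a| ^ 2 - |b| ^ 2), of norm at most
    1 / (|a| - |b|). *)
Lemma right_inverse_of_gap (L : {linear V -> C}) (inj : C -> V) (a b : C) (eta : R) :
  linear inj -> (forall x, `|inj x| = `|x|) ->
  (forall x, L (inj x) = a * x + b * (x^*)%C) ->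
  0 < eta -> `|a| - `|b| > eta ->
  range L = [set: C] /\
  exists2 g : {linear C -> V}, cancel g L & (op_norm g < (eta^-1)%:E)%E.
Proof.
move=> injl injn LE eta0 gap.
have b0 : 0 <= `|b| by [].
have gap0 : 0 < `|a| - `|b| by apply: lt_trans gap.
have a0 : 0 < `|a| by lra.
pose den : R := `|a| ^+ 2 - `|b| ^+ 2.
have denE : den = (`|a| - `|b|) * (`|a| + `|b|) by rewrite -subr_sqr.
have den0 : 0 < den by rewrite denE mulr_gt0 // ltr_wpDr.
pose J (x : C) : C := conjc x.
have sqJ (x : C) : x * (J x) = (`|x| ^+ 2)%:A.
  rewrite sqr_cnorm; case: x => x y; apply/eqP; rewrite eq_complex /=.
  by apply/andP; split; apply/eqP; ring.
have JM (x y : C) : (J (x * y)) = (J x) * (J y) :> C by exact: rmorphM.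
have JB (x y : C) : (J (x - y)) = (J x) - (J y) :> C by exact: rmorphB.
have JZ (k : R) (y : C) : (J (k *: y)) = k *: (J y) :> C.
  by case: y => u v; apply/eqP; rewrite eq_complex /= mulrN !eqxx.
have JD (x y : C) : (J (x + y)) = (J x) + (J y) :> C by exact: rmorphD.
have JJ (x : C) : J (J x) = x by exact: conjcK.
pose t (s : C) : C := den^-1 *: ((J a) * s - b * (J s)).
have tl : linear t.
  move=> k x y; rewrite /t JD JZ !mulrDr -!cscalerAr opprD addrACA -scalerBr.
  by rewrite scalerDr !scalerA [den^-1 * k]mulrC.
have tL s : a * t s + b * (J (t s)) = s.
  rewrite /t JZ -!cscalerAr -scalerDr JB !JM !JJ.
  have -> : a * ((J a) * s - b * (J s)) + b * (a * (J s) - (J b) * s) =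
    (a * (J a) - b * (J b)) * s by ring.
  rewrite !sqJ -scalerBl -scalerAl mul1r scalerA -/den mulVf ?scale1r //.
  by rewrite gt_eqF.
have gl : linear (inj \o t) by move=> k x y; rewrite /= tl injl.
pose gm := GRing.isLinear.Build _ _ _ _ _ gl.
pose g : {linear C -> V} := HB.pack (inj \o t) gm.
have gK : cancel g L by move=> s; rewrite /= LE tL.
split.
  by apply/seteqP; split => // s _; exists (g s) => //; exact: gK.
exists g => //.
apply: (@le_lt_trans _ _ ((`|a| - `|b|)^-1)%:E); last first.
  by rewrite lte_fin ltf_pV2.
apply: ge_ereal_sup => _ [s s1 <-]; rewrite lee_fin /= injn /t normrZ.
rewrite ger0_norm ?invr_ge0 ?(ltW den0) //.
have h : `|(J a) * s - b * (J s) : C| <= `|a| + `|b|.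
  apply: le_trans (ler_normB _ _) _; rewrite !cnormM ![`|J _|]cnormJ.
  by apply: lerD; rewrite ler_piMr.
apply: le_trans (ler_wpM2l _ h) _; first by rewrite invr_ge0 ltW.
rewrite denE invfM -mulrA mulVf ?mulr1 // gt_eqF //.
by rewrite ltr_wpDr.
Qed.

End RightInverse.

Section AffinePerturbation.
Variables (R : realType) (n : nat).
Local Notation C := (Rcomplex R).
Local Notation V := (Cvec R n).

Let lin_part (w : Cvec R n.+1) (z : V) : C := \sum_(i < n) w 0 (lift ord0 i) * z 0 i.

Lemma diff_sub_affine (f : V -> C) (w : Cvec R n.+1) (z : V) i x :
  differentiable f z ->
  'd (fun z : V => f z - w 0 ord0 - \sum_(i < n) w 0 (lift ord0 i) * z 0 i) z (axis i x) =
  (dz f i z - w 0 (lift ord0 i)) * x + dzbar f i z * (x^*)%C.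
Proof.
move=> df.
have ll : linear (lin_part w).
  move=> a u v; rewrite /lin_part scaler_sumr -big_split; apply: eq_bigr => j _.
  by rewrite !mxE mulrDr cscalerAr.
have lB y : `|lin_part w y| <= (\sum_(j < n) `|w 0 (lift ord0 j)|) * `|y|.
  rewrite mulr_suml; apply: le_trans (ler_norm_sum _ _ _) _; apply: ler_sum => j _.
  by rewrite cnormM ler_wpM2l // norm_coord_le.
have ld := bounded_linear_differentiable z ll lB.
have [dl dlE] := is_derive_bounded_linear ll lB (@derivable_id R V z (axis i x)).
have dc : differentiable (cst (w 0 ord0) : V -> C) z by exact: differentiable_cst.
have dfc : differentiable (f - cst (w 0 ord0)) z by exact: differentiableB.
have dF : differentiable ((f - cst (w 0 ord0)) - lin_part w) z by exact: differentiableB.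
have E : 'd ((f - cst (w 0 ord0)) - lin_part w) z (axis i x) =
    'D_(axis i x) f z - lin_part w (axis i x).
  rewrite -(deriveE _ dF) (deriveB (diff_derivable dfc) (diff_derivable ld)).
  rewrite (deriveB (diff_derivable df) (diff_derivable dc)) derive_cst subr0.
  by rewrite -[lin_part w]/(lin_part w \o id) dlE derive_id.
rewrite [LHS]E derive_axis //.
have -> : lin_part w (axis i x) = w 0 (lift ord0 i) * x.
  rewrite /lin_part (bigD1 i) //= mxE eqxx big1 ?addr0 // => j ji.
  by rewrite mxE (negPf ji) mulr0.
by rewrite mulrBl addrAC.
Qed.

End AffinePerturbation.

(** * Approximation of a function and its partial derivatives *)

Section LocalApproximation.
Variables (R : realType) (n : nat).
Local Notation C := (Rcomplex R).
Local Notation V := (Cvec R n).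

Lemma updD (z : V) i (x y : C) : upd z i y = upd z i x + axis i (y - x).
Proof.
apply/rowP => k; rewrite !mxE; case: eqP => _; last by rewrite addr0.
by rewrite addrC subrK.
Qed.

Lemma polydisc_upd (c z : V) (r : R) i (x : C) :
  polydisc c r z -> `|x - c 0 i : C| <= r -> polydisc c r (upd z i x).
Proof. by move=> zP xr k; rewrite mxE; case: eqP => [->|_]; [exact: xr | exact: zP]. Qed.

Variables (eta : R) (f : V -> C).
Local Notation Bp := (ball (0 : V) (11 / 10)).
Hypothesis f_smooth : smooth_on Bp f.
Hypothesis f_C1 : (Cr_norm 1 Bp f <= 1%:E)%E.
Hypothesis dbar_C2 : (Cr_norm 2 Bp (dbar f) <= eta%:E)%E.
Hypothesis eta0 : 0 < eta.

Variables (c : V) (s : R) (d : nat).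
Hypotheses (s0 : 0 < s) (s1 : s <= 1) (d_eta : (2 ^+ d)^-1 <= eta).
Hypothesis c_in : forall z, polydisc c (2 * s) z -> `|z| <= 27 / 25.

Let r_rho : 109 / 100 < 11 / 10 :> R. Proof. lra. Qed.
Let rr : 27 / 25 <= 109 / 100 :> R. Proof. lra. Qed.

Lemma poly_approx_value : exists2 g, polyfun (n * d) g &
  forall z, polydisc c s z -> `|f z - g z| <= 30 * 2 ^+ n * eta.
Proof.
have [K K0 T] := taylor_along_axis f_smooth r_rho.
have [] := @polydisc_approx R n c s f (fun i z => dz f i z) eta K 1 s0 eta0 K0 _ _ d.
- move=> z /c_in zr; apply: (norm_le1_of_C1 f_C1); apply: le_lt_trans zr _; lra.
- move=> i z x y zP xs ys.
  have xr := le_trans (c_in (polydisc_upd zP xs)) rr.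
  have yr := le_trans (c_in (polydisc_upd zP ys)) rr.
  have := T i (upd z i x) (y - x) xr; rewrite -updD => /(_ yr) H.
  rewrite [leRHS]addrC.
  have -> : f (upd z i y) - f (upd z i x) - dz f i (upd z i x) * (y - x) =
   (f (upd z i y) - f (upd z i x) - (dz f i (upd z i x) * (y - x) +
     dzbar f i (upd z i x) * ((y - x)^*)%C)) + dzbar f i (upd z i x) * ((y - x)^*)%C.
    by rewrite opprD addrA subrK.
  apply: le_trans (ler_normD _ _) _; apply: lerD H _.
  rewrite cnormM cnormJ ler_wpM2r //; apply: (dzbar_le dbar_C2).
  apply: le_lt_trans xr _; lra.
move=> g gP gh; exists g => // z zP; apply: le_trans (gh z zP) _.
have -> : 30 * 2 ^+ n * eta = 2 ^+ n * (30 * eta) by ring.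
apply: ler_wpM2l; first exact: exprn_ge0.
have : eta * s <= eta by rewrite ler_piMr // ltW.
move: d_eta; rewrite mulr1; move: (eta * s) ((2 ^+ d)^-1) => y x; move: eta0; lra.
Qed.

(** The partial derivative is approximated through a difference quotient with a
    tiny real step t: the defect of holomorphy of that quotient is a difference
    quotient of dbar f, which the bound on the derivatives of dbar f controls. *)
Lemma poly_approx_dz j : exists2 g, polyfun (n * d) g &
  forall z, polydisc c s z -> `|dz f j z - g z| <= 30 * 2 ^+ n * eta.
Proof.
have [K K0 T] := taylor_along_axis f_smooth r_rho.
(* t <= 1 / 100 keeps the shifted points in the ball of radius 109 / 100, and
   K t <= eta makes the difference quotient eta-close to the x-derivative. *)
have [t t0 [t1 Kt]] : exists2 t : R, 0 < t & t <= 1 / 100 /\ K * t <= eta.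
  exists (Num.min (1 / 100) (eta / (K + 1))); first by rewrite lt_min !divr_gt0 // ltr_wpDl.
  split; first by rewrite ge_min lexx.
  apply: (@le_trans _ _ ((K + 1) * (eta / (K + 1)))).
    apply: ler_pM => //; first by rewrite le_min !divr_ge0 ?addr_ge0 // ltW.
      by rewrite lerDl.
    by rewrite ge_min lexx orbT.
  by rewrite mulrC divfK // gt_eqF // ltr_wpDl.
pose e : V := axis j t%:A.
have en : `|e| = t by rewrite norm_axis normrZ cnorm1 mulr1 ger0_norm // ltW.
have shift z : `|z| <= 27 / 25 -> `|z + e| <= 109 / 100.
  move=> zr; apply: le_trans (ler_normD _ _) _; rewrite en.
  apply: le_trans (lerD zr t1) _; lra.
pose h z : C := t^-1 *: (f (z + e) - f z).
pose a i z : C := t^-1 *: (dz f i (z + e) - dz f i z).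
have ti : `|t^-1| = t^-1 by rewrite ger0_norm // invr_ge0 ltW.
have K'0 : 0 <= 2 * K / t by rewrite !(divr_ge0, mulr_ge0) // ltW.
have [] := @polydisc_approx R n c s h a (2 * eta) (2 * K / t) 2 s0 _ K'0 _ _ d.
- by rewrite mulr_gt0.
- move=> z /c_in zr; rewrite /h normrZ ti mulrC ler_pdivrMr //.
  by apply: (lipschitz_along_x f_smooth f_C1 r_rho) => //; [exact: ltW | exact: le_trans rr | exact: shift].
- move=> i z x y zP xs ys.
  have xr' := c_in (polydisc_upd zP xs); have yr' := c_in (polydisc_upd zP ys).
  have xr := le_trans xr' rr; have yr := le_trans yr' rr.
  have xer := shift _ xr'; have yer := shift _ yr'.
  have := T i (upd z i x) (y - x) xr; rewrite -updD => /(_ yr) H.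
  have := T i (upd z i x + e) (y - x) xer; rewrite addrAC -updD => /(_ yer) H'.
  set X := upd z i x in xr' xr xer H H' *; set Y := upd z i y in yr' yr yer H H' *.
  set E1 : C := f Y - f X - _ in H; set E2 : C := f (Y + e) - f (X + e) - _ in H'.
  have -> : h Y - h X - a i X * (y - x) = t^-1 *:
     ((E2 - E1) + (dzbar f i (X + e) - dzbar f i X) * ((y - x)^*)%C).
    rewrite /h /a mulrC -cscalerAr -!scalerBr /E1 /E2; congr (_ *: _).
    move: ((y - x)^*)%C => q; move: (y - x) => p; ring.
  rewrite normrZ ti mulrC ler_pdivrMr //.
  apply: le_trans (ler_normD _ _) _.
  have D : `|(dzbar f i (X + e) - dzbar f i X) * ((y - x)^*)%C : C| <= 2 * (t * eta) * `|y - x : C|.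
    rewrite cnormM cnormJ ler_wpM2r //.
    by apply: (dzbar_lipschitz_along_x f_smooth dbar_C2 r_rho) => //; exact: ltW.
  apply: le_trans (lerD (le_trans (ler_normB _ _) (lerD H' H)) D) _.
  rewrite le_eqVlt; apply/orP; left; apply/eqP.
  by field; rewrite gt_eqF.
move=> g gP gh; exists g => // z zP.
have zP2 : polydisc c (2 * s) z.
  by move=> k; apply: le_trans (zP k) _; rewrite ler_peMl ?ler1n // ltW.
have zr := c_in zP2.
have hz : `|dz f j z - h z : C| <= 2 * eta.
  have H := T j z t%:A (le_trans zr rr) (shift z zr).
  have tJ : (((t%:A : C))^*)%C = t%:A :> C.
    by apply/eqP; rewrite eq_complex /= mulr0 oppr0 !eqxx.
  rewrite tJ normrZ cnorm1 mulr1 ger0_norm ?(ltW t0) // in H.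
  have sc (y : C) : y * t%:A = t *: y by rewrite -cscalerAr mulr1.
  rewrite !sc in H.
  have -> : dz f j z - h z =
     - (t^-1 *: (f (z + e) - f z - (t *: dz f j z + t *: dzbar f j z))) - dzbar f j z.
    rewrite -scalerDr scalerBr scalerA mulVf ?gt_eqF // scale1r opprB -/(h z).
    by rewrite addrAC addrK.
  apply: le_trans (ler_normB _ _) _; rewrite normrN normrZ ti.
  rewrite mulr_natl mulr2n; apply: lerD.
    rewrite mulrC ler_pdivrMr //; apply: le_trans H _.
    by rewrite expr2 mulrA ler_wpM2r // ltW.
  by apply: (dzbar_le dbar_C2); apply: le_lt_trans zr _; lra.
have -> : dz f j z - g z = (dz f j z - h z) + (h z - g z) by rewrite addrA subrK.
apply: le_trans (ler_normD _ _) _; apply: le_trans (lerD hz (gh z zP)) _.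
have N1 : 1 <= 2 ^+ n :> R by rewrite exprn_ege1 // ler1n.
have es : eta * s <= eta by rewrite ler_piMr // ltW.
have b : 12 * (2 * eta * s) + 2 * 2 / 2 ^+ d <= 28 * eta.
  have -> : 2 * eta * s = 2 * (eta * s) by rewrite mulrA.
  move: d_eta; set x := (_ ^+ d)^-1; set y := eta * s in es *; lra.
apply: le_trans (lerD (lexx _) (ler_wpM2l _ b)) _; first by rewrite exprn_ge0.
have : eta <= 2 ^+ n * eta by rewrite ler_peMl // ltW.
set y := 2 ^+ n; nra.
Qed.

End LocalApproximation.

(** * Covering the ball by polydiscs *)

Section Covering.
Variables (R : realType) (n : nat).
Local Notation C := (Rcomplex R).
Local Notation V := (Cvec R n).

Lemma polydisc_cover (s : R) : 0 < s -> exists cs : seq V,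
  (forall c, c \in cs -> `|c| <= 1) /\
  (forall z : V, `|z| <= 1 -> exists2 c, c \in cs & polydisc c s z).
Proof.
move=> s0; have := @closed_ball_compact R n 1; rewrite compact_cover.
move=> /(_ V [set z : V | `|z| <= 1] (fun c => ball c s)) [].
- by move=> c _; exact: ball_open.
- by move=> z z1; exists z => //; exact: ballxx.
move=> D D1 Dcov; exists (finmap.enum_fset D); split.
  by move=> c /D1; rewrite inE.
move=> z /Dcov[c cD cz]; exists c => // k.
apply: le_trans (ltW (_ : `|z - c| < s)); last first.
  by move: cz; rewrite -ball_normE /= distrC.
by have := norm_coord_le (z - c) k; rewrite !mxE.
Qed.

Lemma polydisc_in_ball (c z : V) (s : R) : polydisc c s z -> `|z| <= `|c| + n%:R * s.
Proof.
move=> zP; have -> : z = c + (z - c) by rewrite addrC subrK.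
apply: le_trans (ler_normD _ _) _; apply: lerD => //.
apply: le_trans (norm_le_sum_coord _) _.
rewrite -[n in leRHS]card_ord mulr_natl -sumr_const; apply: ler_sum => k _.
by rewrite !mxE.
Qed.

(** On a complex line through a nonzero of each of two polynomials, both
    restrict to nonzero polynomials in one variable. *)
Lemma polyfun_prod_neq0 (T : eqType) (e : nat) (cs : seq T) (P : T -> V -> C) :
  (forall c, polyfun e (P c)) -> (forall c, exists w, P c w != 0) ->
  exists w, \prod_(c <- cs) P c w != 0.
Proof.
move=> Pe P0; elim: cs => [|c cs [w1 w1P]].
  by exists 0; rewrite big_nil oner_eq0.
have [w0 w0P] := P0 c.
have Qe := polyfun_prod (F := P) cs Pe.
have [q0 _ q0E] := polyfun_line w0 (w1 - w0) (Pe c).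
have [q1 _ q1E] := polyfun_line w0 (w1 - w0) Qe.
have q0n : q0 != 0.
  apply/eqP => q00; move: w0P; have := q0E 0; rewrite q00 horner0.
  by have -> : w0 + cdilate 0 (w1 - w0) = w0; [apply/rowP => i; rewrite !mxE mul0r addr0 | move=> ->; rewrite eqxx].
have q1n : q1 != 0.
  apply/eqP => q10; move: w1P; have := q1E 1; rewrite q10 horner0.
  by have -> : w0 + cdilate 1 (w1 - w0) = w1; [apply/rowP => i; rewrite !mxE mul1r addrC subrK | move=> ->; rewrite eqxx].
have [t _ qt] := poly_nonroot_near0 (mulf_neq0 q0n q1n) (ltr01 : 0 < 1 :> R).
by exists (w0 + cdilate t (w1 - w0)); rewrite big_cons q0E q1E -hornerM.
Qed.

End Covering.

Section CellRelation.
Variables (R : realType) (n : nat).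
Local Notation C := (Rcomplex R).
Local Notation V := (Cvec R n).
Variables (eta : R) (f : V -> C).
Local Notation Bp := (ball (0 : V) (11 / 10)).
Hypothesis f_smooth : smooth_on Bp f.
Hypothesis f_C1 : (Cr_norm 1 Bp f <= 1%:E)%E.
Hypothesis dbar_C2 : (Cr_norm 2 Bp (dbar f) <= eta%:E)%E.
Hypothesis eta0 : 0 < eta.

(** The parameters w that are bad for a point z of the cell lie near the point
    (f - sum z_i dz_i f, dz_1 f, ..., dz_n f) of C ^ (n + 1); over the cell
    these points follow, up to O(eta), a polynomial map whose image lies in a
    hypersurface P = 0. *)
Lemma cell_relation (c : V) (s : R) (d D : nat) :
  0 < s -> s <= 1 -> (2 ^+ d)^-1 <= eta ->
  (forall z, polydisc c (2 * s) z -> `|z| <= 27 / 25) ->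
  ((n.+1 * (D * (n * d).+1)).+1 ^ n < D ^ n.+1)%N ->
  exists P : Cvec R n.+1 -> C, [/\ polyfun D P, exists w, P w != 0 &
    forall (z : V) (w : Cvec R n.+1), polydisc c s z -> `|z| <= 1 ->
      `|f z - w 0 ord0 - \sum_(i < n) w 0 (lift ord0 i) * z 0 i : C| <= eta ->
      (forall i, `|dz f i z - w 0 (lift ord0 i) : C| <= 2 * eta) ->
      exists2 w' : Cvec R n.+1, P w' = 0 &
        `|w - w'| <= (2 * n%:R + 1) * (30 * 2 ^+ n + 2) * eta].
Proof.
move=> s0 s1 d_eta c_in dim.
have [g0 g0P g0E] := poly_approx_value f_smooth f_C1 dbar_C2 eta0 s0 s1 d_eta c_in.
have Hg j : exists g, polyfun (n * d) g /\
    forall z, polydisc c s z -> `|dz f j z - g z| <= 30 * 2 ^+ n * eta.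
  by have [g] := poly_approx_dz f_smooth f_C1 dbar_C2 eta0 s0 s1 d_eta c_in j; exists g.
have [g gP] := choice Hg.
pose G (k : 'I_n.+1) (z : V) : C :=
  if unlift ord0 k is Some i then g i z else g0 z + - \sum_i z 0 i * g i z.
have G0 z : G ord0 z = g0 z - \sum_i z 0 i * g i z by rewrite /G unlift_none.
have GS i z : G (lift ord0 i) z = g i z by rewrite /G liftK.
have Gpoly k : polyfun (n * d).+1 (G k).
  rewrite /G; case: (unlift ord0 k) => [i|].
    by apply: polyfunW (proj1 (gP i)); rewrite leqnSn.
  apply: polyfunD; first exact: polyfunW g0P.
  apply: (eq_polyfun (F := fun z => -1 * \sum_i z 0 i * g i z)).
    by move=> z; rewrite mulN1r.
  apply: polyfunZ; apply: polyfun_sum => i; rewrite -add1n.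
  by apply: polyfunM; [exact: polyfun_coord | exact: (proj1 (gP i))].
have [P [PD P0 PG]] := algebraic_relation Gpoly dim.
exists P; split => // z w zP z1 wf wd.
exists (\row_k G k z); first exact: PG.
set A := 30 * 2 ^+ n.
have wi i : `|w 0 (lift ord0 i) - g i z : C| <= (A + 2) * eta.
  have -> : w 0 (lift ord0 i) - g i z = (dz f i z - g i z) - (dz f i z - w 0 (lift ord0 i)).
    by ring.
  apply: le_trans (ler_normB _ _) _; rewrite mulrDl; apply: lerD => //.
  exact: (proj2 (gP i)).
have w0 : `|w 0 ord0 - G ord0 z : C| <= eta + A * eta + n%:R * ((A + 2) * eta).
  have -> : w 0 ord0 - G ord0 z =
    - (f z - w 0 ord0 - \sum_(i < n) w 0 (lift ord0 i) * z 0 i) + (f z - g0 z)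
    - \sum_(i < n) z 0 i * (w 0 (lift ord0 i) - g i z).
    have -> : \sum_(i < n) z 0 i * (w 0 (lift ord0 i) - g i z) =
        \sum_(i < n) w 0 (lift ord0 i) * z 0 i - \sum_i z 0 i * g i z.
      by rewrite -sumrB; apply: eq_bigr => i _; rewrite mulrBr [z 0 i * w _ _]mulrC.
    by rewrite G0; ring.
  apply: le_trans (ler_normB _ _) _; apply: lerD.
    by apply: le_trans (ler_normD _ _) _; rewrite normrN; apply: lerD => //; exact: g0E.
  apply: le_trans (ler_norm_sum _ _ _) _.
  rewrite -[n in n%:R]card_ord mulr_natl -sumr_const; apply: ler_sum => i _.
  rewrite cnormM; apply: le_trans (wi i); rewrite ler_piMl //.
  by apply: le_trans z1; exact: norm_coord_le.
apply: le_trans (norm_le_sum_coord _) _; rewrite big_ord_recl.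
have -> : (w - \row_k G k z) 0 ord0 = w 0 ord0 - G ord0 z by rewrite !mxE.
apply: (@le_trans _ _ ((eta + A * eta + n%:R * ((A + 2) * eta)) + n%:R * ((A + 2) * eta))).
  apply: lerD => //; rewrite -[n in n%:R]card_ord mulr_natl -sumr_const.
  by apply: ler_sum => i _; rewrite !mxE GS.
have -> : (2 * n%:R + 1) * (A + 2) * eta =
  (eta + A * eta + n%:R * ((A + 2) * eta)) + n%:R * ((A + 2) * eta) + eta by ring.
by rewrite lerDl ltW.
Qed.

End CellRelation.

(** * Choice of the constants and conclusion *)

Section Numerics.
Variable R : realType.

(** Gives e^(9/8) <= (8/7)^9 <= 4 and e^(1/2) <= 2 below. *)
Lemma expR_inv_le (x : R) : x < 1 -> expR x <= (1 - x)^-1.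
Proof.
move=> x1; rewrite -[expR x]invrK -expRN lef_pV2 ?posrE ?expR_gt0 ?subr_gt0 //.
exact: expR_ge1Dx.
Qed.

Lemma ln_inv_delta_ge (delta : R) : 0 < delta -> delta < 1 / 4 -> 9 / 8 <= ln delta^-1.
Proof.
move=> d0 d4.
have e4 : expR (9 / 8) <= 4 :> R.
  rewrite expRM_natl; apply: (@le_trans _ _ ((8 / 7) ^+ 9)).
    rewrite lerXn2r ?nnegrE ?expR_ge0 ?divr_ge0 //.
    apply: le_trans (expR_inv_le _) _; first lra.
    by rewrite (_ : 1 - 8^-1 = 7 / 8) ?invf_div //; lra.
  by rewrite !exprS expr0; lra.
rewrite -[leLHS]expRK ler_ln ?posrE ?expR_gt0 ?invr_gt0 //.
apply: le_trans e4 _; rewrite -[leLHS]invrK lef_pV2 ?posrE ?invr_gt0 //.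
by move: d4; rewrite div1r => /ltW.
Qed.

Lemma expR_half_le (d : nat) : expR (d%:R / 2) <= 2 ^+ d :> R.
Proof.
rewrite expRM_natl lerXn2r ?nnegrE ?expR_ge0 //.
apply: le_trans (expR_inv_le _) _; first lra.
by rewrite (_ : 1 - 2^-1 = 2^-1) ?invrK //; lra.
Qed.

(** Writing p = (a + 1) m + a, the power L^((a + 1) m) is at least
    ((m + 1) / 8)^(a + 1) by Bernoulli, one degree in m more than (p + 1)^a. *)
Lemma exists_exponent (c : R) (a : nat) : exists p : nat, forall L : R, 9 / 8 <= L ->
  c * (p.+1%:R * L) ^+ a < L ^+ p.
Proof.
pose c' := `|c| * a.+1%:R ^+ a * 8 ^+ a.+1.
have c'0 : 0 <= c' by rewrite !mulr_ge0 // exprn_ge0.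
pose m := Num.bound c'; exists (a.+1 * m + a)%N => L L98.
have L1 : 1 <= L by lra.
have L0 : 0 < L by lra.
have mc : c' < m%:R by apply: archi_boundP.
have bernoulli k : 1 + k%:R / 8 <= L ^+ k.
  elim: k => [|k IH]; first by rewrite mul0r addr0.
  rewrite exprS; apply: (@le_trans _ _ (9 / 8 * (1 + k%:R / 8))).
    by rewrite -natr1; have : 0 <= k%:R :> R by []; lra.
  by apply: ler_pM => //; rewrite ?addr_ge0 ?divr_ge0.
have ber : m.+1%:R / 8 <= L ^+ m.
  apply: le_trans (bernoulli m); rewrite -natr1; lra.
have -> : ((a.+1 * m + a).+1 = a.+1 * m.+1)%N by rewrite mulnS addnC addSn.
rewrite exprD exprMn mulrA ltr_pM2r ?exprn_gt0 //.
rewrite [(a.+1 * m)%N]mulnC exprM.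
have ber' : (m.+1%:R / 8) ^+ a.+1 <= (L ^+ m) ^+ a.+1.
  by rewrite ler_pXn2r // nnegrE // exprn_ge0 // ltW.
apply: lt_le_trans ber'.
rewrite expr_div_n ltr_pdivlMr ?exprn_gt0 // natrM exprMn.
apply: (@le_lt_trans _ _ (c' * m.+1%:R ^+ a)).
  rewrite /c'.
  have -> : c * (a.+1%:R ^+ a * m.+1%:R ^+ a) * 8 ^+ a.+1 =
    c * (a.+1%:R ^+ a * m.+1%:R ^+ a * 8 ^+ a.+1) by rewrite !mulrA.
  have -> : `|c| * a.+1%:R ^+ a * 8 ^+ a.+1 * m.+1%:R ^+ a =
    `|c| * (a.+1%:R ^+ a * m.+1%:R ^+ a * 8 ^+ a.+1) by ring.
  by rewrite ler_wpM2r ?ler_norm // !mulr_ge0 // exprn_ge0.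
rewrite [ltRHS]exprS ltr_pM2r ?exprn_gt0 ?ltr0n //.
by apply: lt_trans mc _; rewrite ltr_nat.
Qed.

End Numerics.

Section Degrees.
Variable R : realType.

(** With X = (p + 1) ln (1 / delta), polynomials of degree d, between 2 X and 3 X,
    approximate f up to O(eta) because 2^d >= 1 / eta; the relations between them
    have a degree O(X^n), so that the last inequality reads, up to constants,
    X^(3 n) < (ln (1 / delta))^p. *)
Lemma exists_degrees (n k : nat) (A : R) : (0 < n)%N -> 0 <= A ->
  exists p : nat, forall delta : R, 0 < delta -> delta < 1 / 4 ->
  let eta := delta / ln delta^-1 ^+ p in
  exists d D : nat, [/\ (2 ^+ d)^-1 <= eta,
    ((n.+1 * (D * (n * d).+1)).+1 ^ n < D ^ n.+1)%N, (0 < D)%N &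
    let Dt := (n.+1 * (k.+1 * D))%N in
    A * eta < delta / (8 * Dt%:R ^+ 2 * Dt.+1%:R)].
Proof.
move=> n0 A0; pose B : R := n.+1%:R * (3 * n%:R + 1) + 1.
have B0 : 0 <= B by rewrite addr_ge0 // mulr_ge0 // addr_ge0 // mulr_ge0.
pose M : R := 2 * n.+1%:R * k.+1%:R.
have M0 : 0 <= M by rewrite !mulr_ge0.
have [p pP] := exists_exponent (16 * A * M ^+ 3 * B ^+ (3 * n)) (3 * n).
exists p => delta d0 d4 eta.
set L := ln delta^-1 in eta *.
have L98 : 9 / 8 <= L by apply: ln_inv_delta_ge.
have L0 : 0 < L by lra.
pose X : R := p.+1%:R * L.
have X1 : 1 <= X.
  have : 1 <= p.+1%:R :> R by rewrite ler1n.
  by rewrite /X; nra.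
have X0 : 0 <= X by lra.
have [d dX1 dX2] : exists2 d : nat, 2 * X <= d%:R & d%:R <= 3 * X.
  exists (Num.truncn (2 * X)).+1; first exact/ltW/truncnS_gt.
  rewrite -natr1; have : (Num.truncn (2 * X))%:R <= 2 * X.
    by rewrite truncn_le // mulr_ge0.
  lra.
pose q := (n.+1 * (n * d).+1).+1; pose D := (q ^ n).+1.
have eta0 : 0 < eta by rewrite divr_gt0 // exprn_gt0.
have LX : eta^-1 <= 2 ^+ d.
  rewrite /eta invfM invrK.
  have -> : delta^-1 = expR L by rewrite lnK // posrE invr_gt0.
  apply: le_trans (expR_half_le _ d).
  apply: (@le_trans _ _ (expR L * expR L ^+ p)).
    apply: ler_wpM2l; first exact: expR_ge0.
    rewrite lerXn2r ?nnegrE ?expR_ge0 ?(ltW L0) //.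
    by have := expR_ge1Dx L; lra.
  rewrite -exprS -expRM_natl ler_expR -/X; lra.
exists d, D; split => //.
- by rewrite -[leRHS]invrK lef_pV2 ?posrE ?exprn_gt0 ?invr_gt0.
- rewrite expnS; apply: (@leq_ltn_trans ((D * q) ^ n)).
    rewrite leq_exp2r // /q mulnCA [leqRHS]mulnS.
    by rewrite -(add1n (D * _)%N) leq_add2r.
  by rewrite expnMn [leqRHS]mulnC ltn_pmul2l ?expn_gt0.
move=> Dt.
have qX : q%:R <= B * X.
  rewrite /q -natr1 natrM -[(n * d).+1%:R]natr1 natrM /B mulrDl mul1r; apply: lerD => //.
  rewrite -mulrA; apply: ler_wpM2l => //; rewrite mulrDl mul1r; apply: lerD => //.
  by rewrite [3 * _]mulrC -mulrA; apply: ler_wpM2l.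
have q1 : 1 <= q%:R :> R by rewrite ler1n.
have DX : D%:R <= 2 * (B * X) ^+ n.
  have qn : q%:R ^+ n <= (B * X) ^+ n.
    by rewrite lerXn2r ?nnegrE //; apply: le_trans qX.
  have q1n : 1 <= q%:R ^+ n :> R by rewrite exprn_ege1.
  by rewrite /D -natr1 natrX; lra.
have DtX : Dt%:R <= M * (B * X) ^+ n.
  have -> : M * (B * X) ^+ n = n.+1%:R * (k.+1%:R * (2 * (B * X) ^+ n)) by rewrite /M; ring.
  by rewrite /Dt !natrM; do 2![apply: ler_wpM2l => //].
have Dt1 : 1 <= Dt%:R :> R by rewrite ler1n /Dt !muln_gt0.
have Dt3 : A * (8 * Dt%:R ^+ 2 * Dt.+1%:R) <= 16 * A * M ^+ 3 * B ^+ (3 * n) * X ^+ (3 * n).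
  have -> : 16 * A * M ^+ 3 * B ^+ (3 * n) * X ^+ (3 * n) =
     A * (16 * (M * (B * X) ^+ n) ^+ 3).
    by rewrite !exprMn [(3 * n)%N]mulnC !exprM; ring.
  apply: ler_wpM2l => //.
  apply: (@le_trans _ _ (16 * Dt%:R ^+ 3)).
    rewrite -[Dt.+1%:R]natr1 [_ ^+ 3]exprSr mulrA.
    have -> : 16 * Dt%:R ^+ 2 * Dt%:R = 8 * Dt%:R ^+ 2 * (2 * Dt%:R) :> R by ring.
    apply: ler_wpM2l; first by rewrite mulr_ge0 ?exprn_ge0.
    lra.
  by apply: ler_wpM2l => //; rewrite lerXn2r ?nnegrE //; apply: le_trans DtX.
have pos : 0 < 8 * Dt%:R ^+ 2 * Dt.+1%:R :> R.
  by rewrite !mulr_gt0 // exprn_gt0 //; lra.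
rewrite ltr_pdivlMr //; set T := 8 * _ * _ in Dt3 *.
have -> : A * eta * T = delta * (A * T) / L ^+ p by rewrite /eta; ring.
rewrite ltr_pdivrMr ?exprn_gt0 // ltr_pM2l //.
exact: le_lt_trans Dt3 (pP L L98).
Qed.

End Degrees.

Theorem proposition3 (R : realType) (n : nat) (hn : (1 <= n)%N) :
  exists p : int,
  let Bplus : set (Cvec R n) := ball 0 (11 / 10) in
  let B : set (Cvec R n) := ball 0 1 in
  forall delta : R, 0 < delta -> delta < 1 / 4 ->
  let eta : R := delta * ln (delta^-1) ^ (- p) in
  forall f : Cvec R n -> Rcomplex R,
  smooth_on Bplus f ->
  (Cr_norm 1 Bplus f <= 1%:E)%E ->
  (Cr_norm 2 Bplus (dbar f) <= eta%:E)%E ->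
  exists2 w : Cvec R n.+1, `|w| <= delta &
    eta_transverse eta B
      (fun z : Cvec R n =>
         f z - w 0 ord0 - \sum_(i < n) w 0 (lift ord0 i) * z 0 i).
Proof.
have nR : 1 <= n%:R :> R by rewrite ler1n.
(* Polydiscs of radius 2 s centered in the unit ball stay within radius
   1 + 2 n s = 27 / 25, which leaves room up to 11 / 10. *)
pose s : R := (25 * n%:R)^-1.
have s0 : 0 < s by rewrite invr_gt0 mulr_gt0 // (lt_le_trans ltr01).
have s1 : s <= 1 by rewrite invf_le1; nra.
have [cs [cs_in_ball cs_cover]] := @polydisc_cover R n s s0.
pose A : R := (2 * n%:R + 1) * (30 * 2 ^+ n + 2).
have A0 : 0 <= A by rewrite mulr_ge0 // addr_ge0 // mulr_ge0 // exprn_ge0.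
have [p pP] := exists_degrees (size cs) hn A0.
exists (Posz p) => Bplus B delta d0 d4 eta f fs f1 f2.
have etaE : eta = delta / ln delta^-1 ^+ p by rewrite /eta -exprnN.
have [d [D []]] := pP delta d0 d4; rewrite -etaE => d_eta dim D0.
set Dt := (n.+1 * _)%N => small.
have eta0 : 0 < eta by apply: lt_le_trans d_eta; rewrite invr_gt0 exprn_gt0.
have c_in (c : Cvec R n) : `|c| <= 1 -> forall z, polydisc c (2 * s) z -> `|z| <= 27 / 25.
  move=> c1 z /polydisc_in_ball zc; apply: le_trans zc _.
  have E : n%:R * (2 * s) = 2 / 25.
    by rewrite /s; field; rewrite gt_eqF // (lt_le_trans ltr01).
  apply: (@le_trans _ _ (1 + 2 / 25)); last lra.
  by apply: lerD => //; rewrite E.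
pose bad (c : Cvec R n) (P : Cvec R n.+1 -> Rcomplex R) :=
  forall (z : Cvec R n) (w : Cvec R n.+1), polydisc c s z -> `|z| <= 1 ->
    `|f z - w 0 ord0 - \sum_(i < n) w 0 (lift ord0 i) * z 0 i : Rcomplex R| <= eta ->
    (forall i, `|dz f i z - w 0 (lift ord0 i) : Rcomplex R| <= 2 * eta) ->
    exists2 w' : Cvec R n.+1, P w' = 0 & `|w - w'| <= A * eta.
have HP (c : Cvec R n) : exists P : Cvec R n.+1 -> Rcomplex R, [/\ polyfun D P, exists w, P w != 0 & `|c| <= 1 -> bad c P].
  have [c1|c1] := leP `|c| 1.
    have [P [PD P0 Pbad]] := cell_relation fs f1 f2 eta0 s0 s1 d_eta (c_in c c1) dim.
    by exists P; split.
  exists (fun=> 1); split; [exact: polyfun_cst | by exists 0; exact: oner_neq0 |].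
  by [].
have [P PP] := choice HP.
pose Q w := \prod_(c <- cs) P c w.
have QD : polyfun (size cs * D) Q.
  have := polyfun_prod (F := P) cs (fun c => let: And3 h _ _ := PP c in h).
  by rewrite big_const_seq count_predT iter_addn_0 mulnC.
have [w1 Qw1] : exists w, Q w != 0.
  by apply: (polyfun_prod_neq0 (e := D)) => c; case: (PP c).
have QD' : polyfun ((size cs).+1 * D) Q by apply: polyfunW QD; rewrite leq_mul2r leqnSn orbT.
have d1 : 0 < delta <= 1 by rewrite d0 /=; lra.
have Dt0 : (0 < Dt)%N by rewrite !muln_gt0.
have [w wd Qw] := polyfun_nonvanishing Dt0 QD' Qw1 d1.
exists w => // z Bz Fz.
have z1 : `|z| < 1 by move: Bz; rewrite /B ball0E.
have fz : differentiable f z by apply: (differentiable_of_smooth fs); apply: lt_trans z1 _; lra.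
have [c ccs zc] := cs_cover z (ltW z1).
have [i wi] : exists i, 2 * eta < `|dz f i z - w 0 (lift ord0 i) : Rcomplex R|.
  apply: contrapT => H.
  have [_ _ /(_ (cs_in_ball c ccs)) Pbad] := PP c.
  have [|i|w' Pw' ww'] := Pbad z w zc (ltW z1).
  - exact: ltW.
  - by rewrite leNgt; apply/negP => h; apply: H; exists i.
  have : Q w' != 0.
    by apply: Qw; rewrite distrC; apply: le_lt_trans ww' small.
  by rewrite /Q (big_rem c ccs) /= Pw' mul0r eqxx.
apply: (@right_inverse_of_gap R _ _ (axis i) (dz f i z - w 0 (lift ord0 i)) (dzbar f i z)).
- exact: axis_linear.
- exact: norm_axis.
- by move=> x; exact: diff_sub_affine.
- exact: eta0.
- have : `|dzbar f i z| <= eta by apply: (dzbar_le f2); apply: lt_trans z1 _; lra.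
  move: wi; set x := `|_|; set y := `|dzbar f i z|; lra.
Qed.
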